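(* Let $\Lambda$ be a finite or countable alphabet and let $\mu$ be a shift-invariant probability measure on $\Lambda^{\mathbb N}$ such that $(\Lambda^{\mathbb N},\mu,\sigma)$ has completely positive entropy but $\mu$ is not a Bernoulli (i.i.d. product) measure. Then every infinite non-superficial deterministic set $S\subset\mathbb N$ destroys $\mu$-normality: for every $\mu$-normal $x\in\Lambda^{\mathbb N}$, $x|_S$ is not $\mu$-normal.
   Context: $\sigma$ is the left shift. $x$ is $\mu$-normal if every finite block $B$ occurs in $x$ with limiting frequency $\mu([B])$. For $S=\{s_1<s_2<\dots\}$, $x|_S=(x_{s_1},x_{s_2},\dots)$. A Bernoulli measure is a product measure $\mu_P$ with $\mu_P([b_1\dots b_k])=p_{b_1}\cdots p_{b_k}$ for a probability vector $P$. A measure-preserving system has completely positive entropy (CPE) if every nontrivial finite measurable partition generates a process of positive entropy. With $y=\mathbbm1_S$, a shift-invariant measure on $\{0,1\}^{\mathbb N}$ is derived from $S$ if it is a weak-* accumulation point of $\frac1n\sum_{i<n}\delta_{\sigma^iy}$; $\mathcal M_y$ is the set of such measures. $S$ is deterministic if every measure derived from $S$ has zero entropy. $S$ is superficial if $\mathcal M_y\subset\mathrm{conv}\{\delta_{\bar0},\delta_{\bar1}\}$ (point masses at $0^\infty,1^\infty$); non-superficial otherwise. *)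

(* Defs.v *)
From HB Require Import structures.
From mathcomp Require Import all_boot all_order all_algebra.
From mathcomp Require Import all_classical all_reals all_analysis.
Set Implicit Arguments. Unset Strict Implicit. Unset Printing Implicit Defensive.
Import Order.TTheory GRing.Theory Num.Theory.
Import numFieldNormedType.Exports.
Local Open Scope classical_set_scope.
Local Open Scope ring_scope.

HB.structure Definition PointedCount := {T of Pointed T & Countable T}.

Definition window {T : Type} (x : nat -> T) (i m : nat) : seq T :=
  [seq x (i + j)%N | j <- iota 0 m].

Definition cyl {T : Type} (w : seq T) : set (nat -> T) :=
  [set x | window x 0 (size w) = w].

Definition cylinders (T : Type) : set (set (nat -> T)) :=
  [set A | exists w : seq T, A = cyl w].

Definition Seq (L : PointedCount.type) :=
  g_sigma_algebraType (@cylinders L).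

Definition shift {T : Type} (x : nat -> T) : nat -> T := fun n => x n.+1.

Definition freq {T : eqType} (R : realType) (x : nat -> T) (n : nat) (w : seq T) : R :=
  (count (fun i => window x i (size w) == w) (iota 0 n))%:R / n%:R.

Definition normal (R : realType) (L : PointedCount.type)
  (mu : probability (Seq L) R) (x : nat -> L) : Prop :=
  forall w : seq L, (fun n => freq R x n w) @ \oo --> fine (mu (cyl w)).

Definition shift_invariant (R : realType) (L : PointedCount.type)
  (mu : probability (Seq L) R) : Prop :=
  forall A : set (Seq L), measurable A -> mu (@shift L @^-1` A) = mu A.

Definition bernoulli (R : realType) (L : PointedCount.type)
  (mu : probability (Seq L) R) : Prop :=
  exists p : L -> R, forall w : seq L, mu (cyl w) = (\prod_(a <- w) p a)%:E.

Definition xlnx (R : realType) (t : R) : R := if t == 0 then 0 else t * ln t.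

(* entropy h(mu, sigma, P) of the process generated by a finite measurable
   partition P (given by its cell-index function) *)
Definition join_cell (L : PointedCount.type) (k n : nat) (P : Seq L -> 'I_k)
  (w : n.-tuple 'I_k) : set (Seq L) :=
  [set x | forall i : 'I_n, P (iter i (@shift L) x) = tnth w i].

Definition part_block_entropy (R : realType) (L : PointedCount.type)
  (mu : probability (Seq L) R) (k : nat) (P : Seq L -> 'I_k) (n : nat) : R :=
  - \sum_(w : n.-tuple 'I_k) xlnx (fine (mu (join_cell P w))).

Definition part_entropy (R : realType) (L : PointedCount.type)
  (mu : probability (Seq L) R) (k : nat) (P : Seq L -> 'I_k) : R :=
  limn (fun n => part_block_entropy mu P n.+1 / n.+1%:R).

Definition CPE (R : realType) (L : PointedCount.type)
  (mu : probability (Seq L) R) : Prop :=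
  forall (k : nat) (P : Seq L -> 'I_k),
    (forall j, measurable (P @^-1` [set j])) ->
    ~ (exists j, mu (P @^-1` [set j]) = 1%E) ->
    0 < part_entropy mu P.

(* Shift-invariant measures on {0,1}^N are represented by their values on
   cylinders nu w = nu([w]); weak-* convergence on {0,1}^N is convergence
   on every cylinder. *)
Definition derived (R : realType) (S : pred nat) (nu : seq bool -> R) : Prop :=
  exists phi : nat -> nat, (forall j, (phi j < phi j.+1)%N) /\
    forall w : seq bool, (fun j => freq R (fun n => S n) (phi j) w) @ \oo --> nu w.

(* Kolmogorov-Sinai entropy of a shift-invariant measure on {0,1}^N
   (computed with the generating partition into 1-cylinders) *)
Definition bin_block_entropy (R : realType) (nu : seq bool -> R) (n : nat) : R :=
  - \sum_(w : n.-tuple bool) xlnx (nu w).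

Definition bin_entropy (R : realType) (nu : seq bool -> R) : R :=
  limn (fun n => bin_block_entropy nu n.+1 / n.+1%:R).

Definition deterministic (R : realType) (S : pred nat) : Prop :=
  forall nu : seq bool -> R, derived S nu -> bin_entropy nu = 0.

(* nu in conv{delta_0^oo, delta_1^oo} *)
Definition superficial (R : realType) (S : pred nat) : Prop :=
  forall nu : seq bool -> R, derived S nu ->
    exists a : R, 0 <= a <= 1 /\ forall w : seq bool,
      nu w = a * (all negb w)%:R + (1 - a) * (all id w)%:R.

Definition nth_in (S : pred nat) (k : nat) : nat :=
  xget 0%N [set n | S n /\ count S (iota 0 n) = k].

Definition restr {T : Type} (x : nat -> T) (S : pred nat) : nat -> T :=
  fun k => x (nth_in S k).

(* Main.v *)
Require Import Defs.
From HB Require Import structures.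
From mathcomp Require Import all_boot all_order all_algebra.
From mathcomp Require Import all_classical all_reals all_analysis.
From mathcomp Require Import zify ring lra.
Import Order.TTheory GRing.Theory Num.Theory.
Import numFieldNormedType.Exports.
Local Open Scope classical_set_scope.
Local Open Scope ring_scope.

Set Implicit Arguments.
Unset Strict Implicit.
Unset Printing Implicit Defensive.

(** Suppose [x] and its restriction to the set are both [mu]-normal.  An ultrafilter
    refining a subsequence that witnesses non-superficiality turns frequencies of
    times into a shift-invariant finitely additive probability on [nat], under which
    the orbit of [x] has law [mu] and the indicator of the set is a zero-entropy
    process.  Complete positivity of entropy forces [mu] to be mixing with respect to
    the remote future, hence (disjointness) the two processes are independent.
    Normality of the restriction then says that [mu] is preserved by sampling along an
    independent copy of the set.  Therefore
      [D a = mu(x_0 = w0, x_a = w) - mu(x_0 = w0) mu(x_a = w)]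
    is a bounded function of the index pattern [a] which is harmonic for the sampling
    chain.  Each step moves the pattern to the right with probability at least the
    density of gaps, which is positive, and [D] tends to 0 at infinity by mixing; so
    [D = 0] and [mu] is a product measure. *)

(** * Finitely additive probabilities and entropy of finite-valued variables *)

(** With an infinite alphabet the sequence space is not compact, so weak-* limits of joint laws of
    [x] and the set could lose mass. Densities along an ultrafilter exist for all subsets of [nat]
    at once, and every joint event lives in one [content]; the price is countable additivity. It is
    recovered on events of finitely many coordinates, where agreement with [mu] on cylinders is
    enough because [mu] already has total mass 1. The limit procedure that needs countable unions is
    carried out on the side of [mu]. The field [ev] lets measurable sets and the full power set both
    serve as families of events. An infinite alphabet may also have infinite entropy, so entropy is
    only applied to finite-valued observables: the indicator of an event, or the index of a letter
    in a fixed word. No tail or Pinsker sigma-algebra is formed; information in the remote future is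
    measured by the numbers [V] and [CH] along late finite blocks. Sampling is observed from times
    that belong to the set, so coordinate 0 of a pattern stays in place and only the later positions
    move. *)

Record content (R : realType) (Om : Type) := Content {
  ev : set (set Om);
  pr : set Om -> R;
  evT : ev setT;
  evC : forall A, ev A -> ev (~` A);
  evI : forall A B, ev A -> ev B -> ev (A `&` B);
  pr_ge0 : forall A, ev A -> 0 <= pr A;
  prT : pr setT = 1;
  prU : forall A B, ev A -> ev B -> A `&` B = set0 ->
    pr (A `|` B) = pr A + pr B }.

Section Content.
Variables (R : realType) (Om : Type) (C : content R Om).

Lemma ev0 : ev C set0.
Proof. by rewrite -setCT; apply: evC; exact: evT. Qed.

Lemma evU A B : ev C A -> ev C B -> ev C (A `|` B).
Proof.
move=> EA EB; rewrite -(setCK (A `|` B)) setCU.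
by apply: evC; apply: evI; apply: evC.
Qed.

Lemma evD A B : ev C A -> ev C B -> ev C (A `\` B).
Proof. by move=> EA EB; rewrite setDE; apply: evI => //; apply: evC. Qed.

Lemma pr0 : pr C set0 = 0.
Proof.
have := prU ev0 ev0 (setI0 set0); rewrite setU0 => /eqP.
by rewrite -subr_eq0 opprD addrA subrr sub0r oppr_eq0 => /eqP.
Qed.

Lemma prID A B : ev C A -> ev C B -> pr C A = pr C (A `&` B) + pr C (A `\` B).
Proof.
move=> EA EB; rewrite -prU ?setUIDK //; [exact: evI|exact: evD|].
by rewrite setDE setIACA setICr setI0.
Qed.

Lemma prC A : ev C A -> pr C (~` A) = 1 - pr C A.
Proof. by move=> EA; rewrite -(prT C) (prID (evT C) EA) setTI setTD addrAC subrr add0r. Qed.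

Lemma pr_le A B : ev C A -> ev C B -> A `<=` B -> pr C A <= pr C B.
Proof.
move=> EA EB AB; rewrite (prID EB EA) (setIidr AB) lerDl pr_ge0 //.
exact: evD.
Qed.

Lemma pr_le1 A : ev C A -> pr C A <= 1.
Proof. by move=> EA; rewrite -(prT C) pr_le //; exact: evT. Qed.

Lemma pr_leU A B : ev C A -> ev C B -> pr C (A `|` B) <= pr C A + pr C B.
Proof.
move=> EA EB; rewrite (prID (evU EA EB) EA) setUK lerD2l.
apply: pr_le => //; first by apply: evD => //; apply: evU.
by move=> x [[|//]].
Qed.

Lemma content_inhabited : inhabited Om.
Proof.
apply: contrapT => h; have /eqP := prT C; have -> : [set: Om] = set0.
  by apply/seteqP; split => // x _; apply: h.
by rewrite pr0 eq_sym oner_eq0.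
Qed.

Lemma ev_big (I : finType) (D : pred I) (F : I -> set Om) :
  (forall i, ev C (F i)) -> ev C (\big[setU/set0]_(i | D i) F i).
Proof. by move=> h; elim/big_ind: _ => //; [exact: ev0|exact: evU]. Qed.

Lemma pr_big (I : finType) (D : pred I) (F : I -> set Om) :
  (forall i, ev C (F i)) -> (forall i j, i != j -> F i `&` F j = set0) ->
  pr C (\big[setU/set0]_(i | D i) F i) = \sum_(i | D i) pr C (F i).
Proof.
move=> EF dj; rewrite -big_filter -[RHS]big_filter.
have: uniq [seq i <- index_enum I | D i] by rewrite filter_uniq // index_enum_uniq.
elim: [seq i <- index_enum I | D i] => [|i s IH /=]; first by rewrite !big_nil pr0.
case/andP => nis us; rewrite !big_cons prU ?IH //.
  by elim/big_ind: _ => //; [exact: ev0|exact: evU].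
rewrite big_distrr /= big_seq big1 // => j js; apply: dj.
by apply: contraNneq nis => ->.
Qed.

Definition rv (A : finType) (X : Om -> A) := forall a, ev C (X @^-1` [set a]).
Definition law (A : finType) (X : Om -> A) (a : A) : R := pr C (X @^-1` [set a]).

Lemma preim_pred (A : finType) (X : Om -> A) (D : pred A) :
  [set w | D (X w)] = \big[setU/set0]_(a | D a) (X @^-1` [set a]).
Proof.
apply/seteqP; split => w; rewrite /= -bigcup_seq_cond /=.
  by move=> DX; exists (X w) => //=; rewrite mem_index_enum.
by case=> a /andP[_ Da] ->.
Qed.

Lemma ev_pred (A : finType) (X : Om -> A) (D : pred A) :
  rv X -> ev C [set w | D (X w)].
Proof. by move=> rX; rewrite preim_pred; apply: ev_big => i; apply: rX. Qed.

Lemma preim_disj (A : finType) (X : Om -> A) (a b : A) : a != b ->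
  (X @^-1` [set a]) `&` (X @^-1` [set b]) = set0.
Proof. by move=> /eqP ab; rewrite -subset0 => w [/= -> ]. Qed.

Lemma pr_pred (A : finType) (X : Om -> A) (D : pred A) :
  rv X -> pr C [set w | D (X w)] = \sum_(a | D a) law X a.
Proof.
by move=> rX; rewrite preim_pred pr_big // => i j; apply: preim_disj.
Qed.

Lemma pr_split (A : finType) (X : Om -> A) (E : set Om) : rv X -> ev C E ->
  pr C E = \sum_a pr C (E `&` X @^-1` [set a]).
Proof.
move=> rX EE; rewrite -pr_big => [|i|i j ij]; last 2 first.
- exact: evI.
- by rewrite setIACA preim_disj // setI0.
rewrite -big_distrr /= -(preim_pred X predT); congr (pr C _).
by apply/seteqP; split => // w [].
Qed.

Lemma law_ge0 (A : finType) (X : Om -> A) a : rv X -> 0 <= law X a.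
Proof. by move=> rX; apply: pr_ge0. Qed.

Lemma law_sum1 (A : finType) (X : Om -> A) : rv X -> \sum_a law X a = 1.
Proof.
move=> rX; rewrite -(prT C) (pr_split rX (evT C)).
by apply: eq_bigr => a _; rewrite setTI.
Qed.

(** Stands for inclusion of the sigma-algebra generated by [Y] in the one generated by [X], without
    naming a factor map. *)
Definition det (A B : Type) (X : Om -> A) (Y : Om -> B) :=
  forall w w', X w = X w' -> Y w = Y w'.

Lemma det_fun (A B : Type) (X : Om -> A) (Y : Om -> B) :
  det X Y -> exists g, Y = g \o X.
Proof.
move=> dXY; case: content_inhabited => w0.
exists (fun a => if pselect (exists w, X w = a) is left e
  then Y (projT1 (cid e)) else Y w0).
apply/funext => w /=; case: pselect => [e|[]]; last by exists w.
by case: (cid e) => w' /= /dXY ->.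
Qed.

Lemma law_comp (A B : finType) (X : Om -> A) (g : A -> B) b : rv X ->
  law (g \o X) b = \sum_(a | g a == b) law X a.
Proof.
move=> rX; rewrite -pr_pred //; congr (pr C _).
by apply/seteqP; split => w /= /eqP.
Qed.

Lemma rv_comp (A B : finType) (X : Om -> A) (g : A -> B) : rv X -> rv (g \o X).
Proof.
move=> rX b; have := ev_pred (fun a => g a == b) rX.
by congr (ev C _); apply/seteqP; split => w /= /eqP.
Qed.

Lemma rv_det (A B : finType) (X : Om -> A) (Y : Om -> B) : rv X -> det X Y -> rv Y.
Proof. by move=> rX /det_fun[g ->]; apply: rv_comp. Qed.

Definition rpair (A B : Type) (X : Om -> A) (Y : Om -> B) := fun w => (X w, Y w).

Lemma rpairP (A B : Type) (X : Om -> A) (Y : Om -> B) w w' :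
  rpair X Y w = rpair X Y w' <-> X w = X w' /\ Y w = Y w'.
Proof. by rewrite /rpair; split=> [h|[-> ->]//]; split; [have := congr1 fst h|have := congr1 snd h]. Qed.

Lemma rpair_preim (A B : finType) (X : Om -> A) (Y : Om -> B) a b :
  rpair X Y @^-1` [set (a, b)] = (X @^-1` [set a]) `&` (Y @^-1` [set b]).
Proof. by apply/seteqP; split => w; rewrite /= /rpair => -[<- <-]. Qed.

Lemma rv_rpair (A B : finType) (X : Om -> A) (Y : Om -> B) :
  rv X -> rv Y -> rv (rpair X Y).
Proof. by move=> rX rY [a b]; rewrite rpair_preim; apply: evI. Qed.

Lemma law_snd (A B : finType) (X : Om -> A) (Y : Om -> B) b : rv X -> rv Y ->
  law Y b = \sum_a law (rpair X Y) (a, b).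
Proof.
move=> rX rY; rewrite /law (pr_split rX (rY b)).
by apply: eq_bigr => a _; rewrite rpair_preim setIC.
Qed.

Lemma law_le (A B : finType) (X : Om -> A) (Y : Om -> B) (g : A -> B) a :
  rv X -> Y = g \o X -> law X a <= law Y (g a).
Proof.
move=> rX ->; apply: pr_le; [exact: rX|exact: rv_comp|].
by move=> w /= ->.
Qed.

Lemma xlnxE (t : R) : xlnx t = t * ln t.
Proof. by rewrite /xlnx; case: eqP => // ->; rewrite mul0r. Qed.

Definition H (A : finType) (X : Om -> A) : R := - \sum_a xlnx (law X a).

Lemma H_ge0 (A : finType) (X : Om -> A) : rv X -> 0 <= H X.
Proof.
move=> rX; rewrite /H oppr_ge0 sumr_le0 // => a _.
rewrite xlnxE mulr_ge0_le0 ?law_ge0 // ln_le0 //; apply: pr_le1; exact: rX.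
Qed.

(** The law of [a] is at most that of its image [g a], so passing to the coarser law inside [ln]
    lowers the entropy sum term by term. *)
Lemma H_le (A B : finType) (X : Om -> A) (Y : Om -> B) :
  rv X -> det X Y -> H Y <= H X.
Proof.
move=> rX /det_fun[g eY]; rewrite /H lerN2.
rewrite (partition_big g predT) //=; apply: ler_sum => b _.
rewrite [leRHS]xlnxE {1}eY law_comp // mulr_suml; apply: ler_sum => a /eqP ga.
rewrite xlnxE; have := law_ge0 a rX; rewrite le_eqVlt => /orP[/eqP <-|p0].
  by rewrite !mul0r.
rewrite ler_pM2l // ler_ln ?posrE //.
  by rewrite -ga; apply: law_le.
by apply: lt_le_trans p0 _; rewrite -ga; apply: law_le.
Qed.

Lemma H_eq (A B : finType) (X : Om -> A) (Y : Om -> B) :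
  rv X -> det X Y -> det Y X -> H X = H Y.
Proof.
move=> rX XY YX; apply/eqP; rewrite eq_le !H_le //.
exact: rv_det XY.
Qed.

(* [ln t <= t - 1] at [t = pxz * pyz / (p * pz)] *)
Lemma submod_term (p pz pxz pyz : R) : 0 <= p -> p <= pxz -> p <= pyz -> p <= pz ->
  p - pxz * pyz / pz <= p * (ln p + ln pz - ln pxz - ln pyz).
Proof.
rewrite le_eqVlt => /orP[/eqP <-|p0] h1 h2 h3.
  by rewrite mul0r sub0r oppr_le0 divr_ge0 // mulr_ge0.
have x0 : 0 < pxz by apply: lt_le_trans h1.
have y0 : 0 < pyz by apply: lt_le_trans h2.
have z0 : 0 < pz by apply: lt_le_trans h3.
set t := pxz * pyz / (p * pz).
have t0 : 0 < t by rewrite divr_gt0 // mulr_gt0.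
have lt1 : ln t <= t - 1.
  by rewrite -{1}(subrK 1 t) addrC le_ln1Dx // ltrBrDr addNr.
have lnt : ln t = ln pxz + ln pyz - ln p - ln pz.
  by rewrite /t ln_div ?posrE ?mulr_gt0 // !lnM ?posrE //; ring.
have -> : p - pxz * pyz / pz = p * (1 - t) by rewrite /t; field; rewrite !gt_eqF.
by rewrite ler_pM2l //; move: lt1; rewrite lnt; lra.
Qed.

(** Nonnegativity of the conditional mutual information given [Z]: Gibbs' inequality against the
    weights [pxz * pyz / pz], for which [X] and [Y] are conditionally independent. *)
Lemma H_submod (A B D : finType) (X : Om -> A) (Y : Om -> B) (Z : Om -> D) :
  rv X -> rv Y -> rv Z ->
  H (rpair (rpair X Y) Z) + H Z <= H (rpair X Z) + H (rpair Y Z).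
Proof.
move=> rX rY rZ; have rXZ := rv_rpair rX rZ; have rYZ := rv_rpair rY rZ.
have rXY := rv_rpair rX rY; have rW := rv_rpair rXY rZ.
pose W := rpair (rpair X Y) Z; pose p := law W.
(* All four entropies become sums over the values of the joint variable [W], ready for a termwise
   comparison. *)
have HE (B' : finType) (V : Om -> B') (g : A * B * D -> B') : V = g \o W ->
    H V = - \sum_w p w * ln (law V (g w)).
  move=> eV; rewrite /H; congr (- _).
  rewrite [RHS](partition_big g predT) //=; apply: eq_bigr => b _.
  rewrite xlnxE {1}eV law_comp // mulr_suml; apply: eq_bigr => a /eqP <- //.
rewrite (HE _ (rpair (rpair X Y) Z) id) // (HE _ Z snd) //.
rewrite (HE _ (rpair X Z) (fun w => (w.1.1, w.2))) //.
rewrite (HE _ (rpair Y Z) (fun w => (w.1.2, w.2))) //.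
rewrite -!opprD lerN2 -!big_split /= -subr_ge0 -sumrB.
apply: le_trans (_ : \sum_(w : A * B * D) (p w - law (rpair X Z) (w.1.1, w.2) *
  law (rpair Y Z) (w.1.2, w.2) / law Z w.2) <= _); last first.
  apply: ler_sum => w _; apply: le_trans (submod_term (pz := law Z w.2) _ _ _ _) _.
  - exact: law_ge0.
  - exact: (@law_le _ _ W (rpair X Z) (fun w => (w.1.1, w.2))).
  - exact: (@law_le _ _ W (rpair Y Z) (fun w => (w.1.2, w.2))).
  - exact: (@law_le _ _ W Z snd).
  by rewrite le_eqVlt; apply/orP; left; apply/eqP; rewrite -/p; ring.
rewrite sumrB law_sum1 //.
rewrite -(pair_bigA _ (fun (u : A * B) (z : D) => law (rpair X Z) (u.1, z) *
  law (rpair Y Z) (u.2, z) / law Z z)) /= exchange_big /=.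
rewrite -(law_sum1 rZ) -sumrB sumr_ge0 // => z _.
rewrite -(pair_bigA _ (fun (x : A) (y : B) => law (rpair X Z) (x, z) *
  law (rpair Y Z) (y, z) / law Z z)) /=.
under eq_bigr do rewrite -mulr_suml -mulr_sumr -(law_snd _ rY rZ).
rewrite -mulr_suml -mulr_suml -(law_snd _ rX rZ).
have [->|nz] := eqVneq (law Z z) 0; first by rewrite !mul0r subrr.
by rewrite mulfK // subrr.
Qed.

Definition CH (A B : finType) (X : Om -> A) (Y : Om -> B) := H (rpair X Y) - H Y.

Lemma CH_ge0 (A B : finType) (X : Om -> A) (Y : Om -> B) :
  rv X -> rv Y -> 0 <= CH X Y.
Proof.
move=> rX rY; rewrite /CH subr_ge0; apply: H_le; first exact: rv_rpair.
by move=> w w' /rpairP[].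
Qed.

(** Submodularity when [Z] is a function of [Y]: adjoining [Z] to [Y] adds no information. *)
Lemma CH_cond_le (A B D : finType) (X : Om -> A) (Y : Om -> B) (Z : Om -> D) :
  rv X -> rv Y -> det Y Z -> CH X Y <= CH X Z.
Proof.
move=> rX rY dYZ; have rZ := rv_det rY dYZ.
have := H_submod rX rY rZ.
rewrite (@H_eq _ _ (rpair (rpair X Y) Z) (rpair X Y)); last 3 first.
- by apply: rv_rpair => //; apply: rv_rpair.
- by move=> w w'; rewrite /rpair; congruence.
- by move=> w w' [e h]; rewrite /rpair e h (dYZ _ _ h).
rewrite (@H_eq _ _ (rpair Y Z) Y); last 3 first.
- exact: rv_rpair.
- by move=> w w'; rewrite /rpair; congruence.
- by move=> w w' h; rewrite /rpair h (dYZ _ _ h).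
by rewrite /CH; lra.
Qed.

Lemma CH_chain (A B D : finType) (X : Om -> A) (X' : Om -> B) (Y : Om -> D) :
  rv X -> rv X' -> rv Y ->
  CH (rpair X X') Y = CH X (rpair X' Y) + CH X' Y.
Proof.
move=> rX rX' rY; rewrite /CH.
rewrite (@H_eq _ _ (rpair (rpair X X') Y) (rpair X (rpair X' Y))); first by ring.
- by apply: rv_rpair => //; apply: rv_rpair.
- by move=> w w'; rewrite /rpair; congruence.
- by move=> w w'; rewrite /rpair; congruence.
Qed.

Lemma CH_le (A B D : finType) (X : Om -> A) (X' : Om -> B) (Y : Om -> D) :
  rv X -> rv Y -> det (rpair X Y) X' -> CH X' Y <= CH X Y.
Proof.
move=> rX rY dX; rewrite /CH lerD2r; apply: H_le; first exact: rv_rpair.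
by move=> w w' h; rewrite /rpair (dX _ _ h); case: h => _ ->.
Qed.

Lemma CH_leH (A B : finType) (X : Om -> A) (Y : Om -> B) :
  rv X -> rv Y -> CH X Y <= H X.
Proof.
move=> rX rY; apply: le_trans (@CH_cond_le _ _ _ X Y (fun=> tt) rX rY _) _ => //.
rewrite /CH lerBlDr (@H_eq _ _ _ X).
- by rewrite lerDl H_ge0 //; apply: rv_det rX _.
- by apply: rv_rpair => //; apply: rv_det rX _.
- by move=> w w' /rpairP[].
- by move=> w w'; rewrite /rpair => ->.
Qed.

Definition tup (K : Type) (F : nat -> Om -> K) n : Om -> n.-tuple K :=
  fun w => [tuple F i w | i < n].

Lemma tupP (K : Type) (F : nat -> Om -> K) n w w' :
  tup F n w = tup F n w' <-> forall i, (i < n)%N -> F i w = F i w'.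
Proof.
split=> [h i ltin|h]; last first.
  by apply: eq_from_tnth => i; rewrite !tnth_mktuple h.
by have := congr1 (fun t => tnth t (Ordinal ltin)) h; rewrite !tnth_mktuple.
Qed.

Lemma rv_cst (B : finType) (b : B) : rv (fun=> b).
Proof.
move=> b'; have [->|/eqP nb] := eqVneq b b'.
  by rewrite preimage_cst mem_set //=; exact: evT.
by rewrite preimage_cst memNset //; exact: ev0.
Qed.

Lemma rv_tup (K : finType) (F : nat -> Om -> K) n :
  (forall i, rv (F i)) -> rv (tup F n).
Proof.
move=> rF; elim: n => [|n IH].
  by apply: (rv_det (rv_cst tt)) => w w' _; apply/tupP.
apply: (rv_det (rv_rpair IH (rF n))) => w w' /rpairP[/tupP h1 h2]; apply/tupP => i.
by rewrite ltnS leq_eqVlt => /orP[/eqP ->|/h1].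
Qed.

Lemma CH_tup (K D : finType) (F : nat -> Om -> K) n (Z : Om -> D) :
  (forall i, rv (F i)) -> rv Z ->
  CH (tup F n) Z <= \sum_(i < n) CH (F i) Z.
Proof.
move=> rF rZ; elim: n => [|n IH].
  rewrite big_ord0 /CH subr_le0; apply: H_le => //.
  by move=> w w' h; rewrite /rpair h; congr (_, _); apply/tupP.
rewrite big_ord_recr /=.
apply: le_trans (@CH_le _ _ _ (rpair (F n) (tup F n)) _ _ _ _ _) _ => //.
- by apply: rv_rpair => //; apply: rv_tup.
- move=> w w' /rpairP[/rpairP[h1 /tupP h2] _]; apply/tupP => i.
  by rewrite ltnS leq_eqVlt => /orP[/eqP ->|/h2].
rewrite CH_chain //; last exact: rv_tup.
rewrite addrC lerD // CH_cond_le //.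
  by apply: rv_rpair => //; apply: rv_tup.
by move=> w w' /rpairP[].
Qed.

End Content.

(** * Mutual information and conditional variance *)

Section Information.
Variables (R : realType) (Om : Type) (C : content R Om).
Local Notation H := (H C).
Local Notation CH := (CH C).
Local Notation law := (law C).
Local Notation rv := (rv C).

Lemma ln_leB1 (t : R) : 0 < t -> ln t <= t - 1.
Proof. by move=> t0; rewrite -{1}(subrK 1 t) addrC le_ln1Dx // ltrBrDr addNr. Qed.

Lemma mutual_infoE (A B : finType) (X : Om -> A) (Y : Om -> B) :
  rv X -> rv Y ->
  H X + H Y - H (rpair X Y) = \sum_(w : A * B) law (rpair X Y) w *
    (ln (law (rpair X Y) w) - ln (law X w.1) - ln (law Y w.2)).
Proof.
move=> rX rY; have rW := rv_rpair rX rY; pose W := rpair X Y.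
have HE (B' : finType) (V : Om -> B') (g : A * B -> B') : V = g \o W ->
    H V = - \sum_w law W w * ln (law V (g w)).
  move=> eV; rewrite /H; congr (- _).
  rewrite [RHS](partition_big g predT) //=; apply: eq_bigr => b _.
  by rewrite xlnxE {1}eV law_comp // mulr_suml; apply: eq_bigr => a /eqP <-.
rewrite (HE _ X fst) // (HE _ Y snd) // (HE _ (rpair X Y) id) //= opprK.
by rewrite -!sumrN -!big_split /=; apply: eq_bigr => w _; rewrite -/W; ring.
Qed.

Lemma law_rpair_le (A B : finType) (X : Om -> A) (Y : Om -> B) w :
  rv X -> rv Y -> law (rpair X Y) w <= law X w.1 /\ law (rpair X Y) w <= law Y w.2.
Proof.
move=> rX rY; have rW := rv_rpair rX rY; split.
- exact: (@law_le _ _ C _ _ (rpair X Y) X fst).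
- exact: (@law_le _ _ C _ _ (rpair X Y) Y snd).
Qed.

(** For [p > 0] this is the equality case of [ln t <= t - 1] at [t = a * b / p], which forces
    [t = 1]. *)
Lemma indep_term (p a b : R) : 0 <= p -> p <= a -> p <= b ->
  p * (ln p - ln a - ln b) = p - a * b -> p = a * b.
Proof.
rewrite le_eqVlt => /orP[/eqP <-|p0] h1 h2; first by rewrite mul0r; lra.
have a0 : 0 < a by apply: lt_le_trans h1.
have b0 : 0 < b by apply: lt_le_trans h2.
set t := a * b / p; have t0 : 0 < t by rewrite divr_gt0 // mulr_gt0.
have lnt : ln t = ln a + ln b - ln p.
  by rewrite /t ln_div ?posrE ?mulr_gt0 // !lnM ?posrE //; ring.
have -> : ln p - ln a - ln b = - ln t by rewrite lnt; ring.
have -> : a * b = p * t by rewrite /t; field; rewrite gt_eqF.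
move=> e; have {e} lt1 : 1 + ln t = t.
  by apply: (mulfI (lt0r_neq0 p0)); move: e; lra.
have [l0|/expR_gt1Dx] := eqVneq (ln t) 0; first by rewrite -lt1 l0 addr0 mulr1.
by rewrite lnK ?posrE // lt1 ltxx.
Qed.

(** Each divergence term exceeds [p - a * b] by a nonnegative amount, and these amounts sum to the
    mutual information, which is at most 0; so each vanishes and the equality case applies. *)
Lemma indep_of_entropy (A B : finType) (X : Om -> A) (Y : Om -> B) a b :
  rv X -> rv Y -> H X + H Y <= H (rpair X Y) ->
  law (rpair X Y) (a, b) = law X a * law Y b.
Proof.
move=> rX rY; rewrite -subr_le0 mutual_infoE // => le0.
have rW := rv_rpair rX rY; set p := law (rpair X Y).
pose t w := p w * (ln (p w) - ln (law X w.1) - ln (law Y w.2)) -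
  (p w - law X w.1 * law Y w.2).
have t_ge0 w : 0 <= t w.
  have [h1 h2] := law_rpair_le w rX rY.
  have pw : 0 <= p w by apply: law_ge0.
  have := submod_term pw h1 h2 (pr_le1 (rW w)).
  by rewrite ln1 divr1 addr0 -subr_ge0 /t.
have st : \sum_w t w <= 0.
  rewrite sumrB sumrB -/p in le0 *; rewrite law_sum1 //.
  rewrite -(pair_bigA _ (fun x y => law X x * law Y y)) /=.
  under [X in _ - (_ - X)]eq_bigr do rewrite -mulr_sumr law_sum1 // mulr1.
  by rewrite law_sum1 // subrr subr0.
have t0 : \sum_w t w = 0 by apply/eqP; rewrite eq_le st sumr_ge0.
have tE : t (a, b) = 0 by apply: (psumr_eq0P (fun w _ => t_ge0 w) t0).
have [h1 h2] := law_rpair_le (a, b) rX rY.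
apply: indep_term => //; first exact: law_ge0.
by apply/eqP; rewrite -subr_eq0; apply/eqP; move: tE.
Qed.

(* [V E Z] is the squared [L^2] norm of the conditional expectation of [E]
   given [Z], and [cm E Z] is that conditional expectation. *)
Definition cm (E : set Om) (A : finType) (Z : Om -> A) (z : A) : R :=
  pr C (E `&` (Z @^-1` [set z])) / law Z z.
Definition V (E : set Om) (A : finType) (Z : Om -> A) : R :=
  \sum_z law Z z * cm E Z z ^+ 2.

Lemma law_cm E (A : finType) (Z : Om -> A) z : ev C E -> rv Z ->
  law Z z * cm E Z z = pr C (E `&` Z @^-1` [set z]).
Proof.
move=> EE rZ; rewrite /cm mulrCA.
have [l0|nz] := eqVneq (law Z z) 0; last by rewrite divff // mulr1.
rewrite l0 mul0r mulr0; apply/eqP; rewrite eq_le pr_ge0 /=; last exact: evI.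
by rewrite -l0; apply: pr_le => //; exact: evI.
Qed.

Lemma cm_ge0 E (A : finType) (Z : Om -> A) z : ev C E -> rv Z -> 0 <= cm E Z z.
Proof.
by move=> EE rZ; rewrite /cm divr_ge0 ?law_ge0 // pr_ge0 //; exact: evI.
Qed.

Lemma cm_le1 E (A : finType) (Z : Om -> A) z : ev C E -> rv Z -> cm E Z z <= 1.
Proof.
move=> EE rZ; rewrite /cm; have := law_ge0 z rZ.
rewrite le_eqVlt => /orP[/eqP <-|l0]; first by rewrite invr0 mulr0.
by rewrite ler_pdivrMr // mul1r; apply: pr_le => //; exact: evI.
Qed.

Lemma sum_law_cm E (A : finType) (Z : Om -> A) : ev C E -> rv Z ->
  \sum_z law Z z * cm E Z z = pr C E.
Proof.
move=> EE rZ; rewrite (pr_split rZ EE); apply: eq_bigr => z _; exact: law_cm.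
Qed.

Lemma V_cst E (A : finType) (Z : Om -> A) : ev C E -> rv Z ->
  \sum_z law Z z * (cm E Z z - pr C E) ^+ 2 = V E Z - pr C E ^+ 2.
Proof.
move=> EE rZ; have -> : pr C E ^+ 2 =
    2 * pr C E * (\sum_z law Z z * cm E Z z) - pr C E ^+ 2 * \sum_z law Z z.
  by rewrite sum_law_cm // law_sum1 //; ring.
rewrite /V !mulr_sumr -!sumrB; apply: eq_bigr => z _; ring.
Qed.

Lemma V_le1 E (A : finType) (Z : Om -> A) : ev C E -> rv Z -> V E Z <= 1.
Proof.
move=> EE rZ; rewrite -(law_sum1 rZ); apply: ler_sum => z _.
rewrite -[leRHS]mulr1 ler_wpM2l ?law_ge0 // exprn_ile1 //.
- exact: cm_ge0.
- exact: cm_le1.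
Qed.

(** Pythagoras: conditioning on [g \o X] is the orthogonal projection of conditioning on [X]. *)
Lemma V_parseval E (A B : finType) (X : Om -> A) (g : A -> B) : ev C E -> rv X ->
  \sum_a law X a * (cm E X a - cm E (g \o X) (g a)) ^+ 2 = V E X - V E (g \o X).
Proof.
move=> EE rX; have rY := rv_comp g rX.
have cross : \sum_a law X a * cm E X a * cm E (g \o X) (g a) = V E (g \o X).
  rewrite (partition_big g predT) //=; apply: eq_bigr => b _.
  rewrite expr2 mulrA (law_cm b EE rY).
  transitivity ((\sum_(a | g a == b) law X a * cm E X a) * cm E (g \o X) b).
    by rewrite mulr_suml; apply: eq_bigr => a /eqP ->.
  congr (_ * _).
  rewrite (pr_split rX (evI EE (rY b))) big_mkcond /=; apply: eq_bigr => a _.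
  case: eqP => [<-|ne].
    rewrite law_cm //; congr (pr C _); apply/seteqP; split => w /=.
      by case=> ? <-.
    by case=> [[? _] ?].
  rewrite -(pr0 C); congr (pr C _); apply/esym.
  by rewrite -subset0 => w /= [[_ e1] e2]; apply: ne; rewrite -e1 /= e2.
have sq : \sum_a law X a * cm E (g \o X) (g a) ^+ 2 = V E (g \o X).
  rewrite (partition_big g predT) //=; apply: eq_bigr => b _.
  by rewrite law_comp // mulr_suml; apply: eq_bigr => a /eqP ->.
have -> : V E X - V E (g \o X) =
    V E X - 2 * V E (g \o X) + V E (g \o X) by ring.
rewrite -{1}cross -sq /V mulr_sumr -sumrB -big_split /=.
apply: eq_bigr => a _; ring.
Qed.

Lemma V_le E (A B : finType) (X : Om -> A) (Y : Om -> B) : ev C E -> rv X ->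
  det X Y -> V E Y <= V E X.
Proof.
move=> EE rX /det_fun-/(_ R C)[g ->]; rewrite -subr_ge0 -V_parseval //.
by apply: sumr_ge0 => a _; rewrite mulr_ge0 ?law_ge0 // sqr_ge0.
Qed.

(** Both conditional expectations are projections of the one given [W], at squared distances at most
    [v - V E X] and [v - V E Y]. Chebyshev and [(s - t)^2 <= 2 s^2 + 2 t^2] conclude. *)
Lemma cm_close E (A B D : finType) (X : Om -> A) (Y : Om -> B) (W : Om -> D)
    (v eta : R) :
  ev C E -> rv W -> det W X -> det W Y -> V E W <= v -> 0 < eta ->
  pr C [set w | eta <= `|cm E X (X w) - cm E Y (Y w)|] <=
    2 * (2 * v - V E X - V E Y) / eta ^+ 2.
Proof.
move=> EE rW /det_fun-/(_ R C)[g ->] /det_fun-/(_ R C)[h ->] Vv eta0.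
pose f a := cm E (g \o W) (g a); pose k a := cm E (h \o W) (h a).
rewrite (pr_pred (fun a => eta <= `|f a - k a|) rW).
rewrite ler_pdivlMr ?exprn_gt0 // mulr_suml.
apply: le_trans (_ : \sum_a law W a * (f a - k a) ^+ 2 <= _).
  rewrite big_mkcond /=; apply: ler_sum => a _; case: ifP => [ha|_].
    rewrite ler_wpM2l ?law_ge0 // -[leRHS]real_normK ?num_real //.
    by rewrite ler_pXn2r ?nnegrE // ltW.
  by rewrite mulr_ge0 ?law_ge0 // sqr_ge0.
apply: le_trans (_ : 2 * (\sum_a law W a * (cm E W a - f a) ^+ 2) +
  2 * (\sum_a law W a * (cm E W a - k a) ^+ 2) <= _); last first.
  by rewrite !V_parseval //; lra.
rewrite !mulr_sumr -big_split /=; apply: ler_sum => a _.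
rewrite -subr_ge0; have -> : 2 * (law W a * (cm E W a - f a) ^+ 2) +
  2 * (law W a * (cm E W a - k a) ^+ 2) - law W a * (f a - k a) ^+ 2 =
  law W a * ((cm E W a - f a) + (cm E W a - k a)) ^+ 2 by ring.
by rewrite mulr_ge0 ?law_ge0 // sqr_ge0.
Qed.

(** The deviation is the integral of [cm E Z - pr C E] over the event, hence at most its L1 norm;
    AM-GM bounds this by the variance, which is at most [e ^+ 2]. *)
Lemma V_mixing E (A : finType) (Z : Om -> A) (D : pred A) (e : R) :
  ev C E -> rv Z -> 0 < e -> V E Z <= pr C E ^+ 2 + e ^+ 2 ->
  `|pr C (E `&` [set w | D (Z w)]) - pr C E * pr C [set w | D (Z w)]| <= e.
Proof.
move=> EE rZ e0 hV.
have ED := ev_pred D rZ.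
have -> : pr C (E `&` [set w | D (Z w)]) - pr C E * pr C [set w | D (Z w)] =
    \sum_(z | D z) law Z z * (cm E Z z - pr C E).
  rewrite (pr_split rZ (evI EE ED)) (pr_pred D rZ) mulr_sumr.
  rewrite big_mkcond [X in _ - X]big_mkcond [RHS]big_mkcond /= -sumrB.
  apply: eq_bigr => z _; case: ifP => Dz.
    rewrite mulrBr law_cm //; congr (_ - _); last by rewrite mulrC.
    congr (pr C _); apply/seteqP; split => w /=; first by case=> [[]].
    by case=> ? e1; rewrite e1.
  rewrite subr0 -(pr0 C); congr (pr C _).
  by rewrite -subset0 => w /= [[_ DZ] e1]; rewrite e1 Dz in DZ.
apply: le_trans (ler_norm_sum _ _ _) _.
apply: le_trans (_ : \sum_z law Z z * ((cm E Z z - pr C E) ^+ 2 / e + e) / 2 <= _).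
  rewrite big_mkcond /=; apply: ler_sum => z _.
  have l0 := law_ge0 z rZ; set x := cm E Z z - pr C E.
  case: ifP => _; last first.
    by rewrite !mulr_ge0 ?addr_ge0 ?divr_ge0 ?sqr_ge0 // ltW.
  rewrite normrM (ger0_norm l0) -mulrA ler_wpM2l //.
  (* AM-GM: [2 |x| <= x^2 / e + e] *)
  rewrite ler_pdivlMr // -subr_ge0.
  have -> : x ^+ 2 / e + e - `|x| * 2 = (`|x| - e) ^+ 2 / e.
    by rewrite -[x ^+ 2]real_normK ?num_real //; field; rewrite gt_eqF.
  by rewrite divr_ge0 ?sqr_ge0 // ltW.
have -> : \sum_z law Z z * ((cm E Z z - pr C E) ^+ 2 / e + e) / 2 =
    ((\sum_z law Z z * (cm E Z z - pr C E) ^+ 2) / e + e * \sum_z law Z z) / 2.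
  rewrite mulr_suml mulr_sumr -big_split /= mulr_suml.
  by apply: eq_bigr => z _; ring.
rewrite V_cst // law_sum1 // mulr1 ler_pdivrMr // mulrDr mulr1 lerD2r.
by rewrite ler_pdivrMr // -expr2; lra.
Qed.

Lemma chi2_term (p a b : R) : 0 <= p -> p <= a -> p <= b ->
  p * (ln p - ln a - ln b) <= p ^+ 2 / (a * b) - p.
Proof.
rewrite le_eqVlt => /orP[/eqP <-|p0] h1 h2.
  by rewrite mul0r expr0n /= mul0r subrr.
have a0 : 0 < a by apply: lt_le_trans h1.
have b0 : 0 < b by apply: lt_le_trans h2.
set t := p / (a * b); have t0 : 0 < t by rewrite divr_gt0 // mulr_gt0.
have -> : ln p - ln a - ln b = ln t.
  by rewrite /t ln_div ?posrE ?mulr_gt0 // !lnM ?posrE //; ring.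
have -> : p ^+ 2 / (a * b) - p = p * (t - 1).
  by rewrite /t; field; rewrite !gt_eqF.
by rewrite ler_pM2l // ln_leB1.
Qed.

(** The divergence is bounded by the chi-square distance, which is a weighted sum of the [V] of the
    cells: decorrelation of each cell becomes near independence in entropy. *)
Lemma CH_ge_of_V (A B : finType) (X : Om -> A) (Z : Om -> B) (e : R) :
  rv X -> rv Z ->
  (forall a, V (X @^-1` [set a]) Z <= law X a ^+ 2 + e) -> 0 <= e ->
  H X - e * (\sum_a (law X a)^-1) <= CH X Z.
Proof.
move=> rX rZ hV e0; have rW := rv_rpair rX rZ.
suff : H X + H Z - H (rpair X Z) <= e * (\sum_a (law X a)^-1).
  by rewrite /CH -/H; lra.
rewrite mutual_infoE //.
apply: le_trans (_ : \sum_(w : A * B) (law (rpair X Z) w ^+ 2 /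
   (law X w.1 * law Z w.2) - law (rpair X Z) w) <= _).
  apply: ler_sum => w _; have [h1 h2] := law_rpair_le w rX rZ.
  by apply: chi2_term => //; apply: law_ge0.
rewrite sumrB law_sum1 // lerBlDr -(law_sum1 rX) mulr_sumr -big_split /=.
rewrite [leLHS](_ : _ = \sum_x \sum_z law (rpair X Z) (x, z) ^+ 2 /
  (law X x * law Z z)); last by rewrite pair_bigA; apply: eq_bigr => -[a z].
apply: ler_sum => a _.
have -> : \sum_z law (rpair X Z) (a, z) ^+ 2 / (law X a * law Z z) =
    V (X @^-1` [set a]) Z / law X a.
  rewrite /V mulr_suml; apply: eq_bigr => z _.
  rewrite expr2 [in RHS]mulrA law_cm // /cm -rpair_preim invfM.
  by rewrite -!/(law _ _); ring.
have := law_ge0 a rX; rewrite le_eqVlt => /orP[/eqP <-|l0].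
  by rewrite invr0 !mulr0 addr0.
rewrite ler_pdivrMr // mulrDl mulfVK ?gt_eqF // addrC -expr2.
exact: hV.
Qed.

Lemma H_bool_small (e : R) : 0 < e -> exists2 d, 0 < d &
  forall B : Om -> bool, rv B -> law B true <= d -> H B <= e.
Proof.
(* The threshold [s ^+ 2] bounds [- t ln t] by [2 * s], writing [- ln t] as [ln (s / t) + ln s^-1];
   the other term is at most [t <= s], and [3 * s <= e]. *)
move=> e0; pose s := Num.min 2^-1 (e / 4).
have s0 : 0 < s by rewrite lt_min; apply/andP; split; lra.
have s2 : s <= 2^-1 by rewrite /s ge_min lexx.
have se : s <= e / 4 by rewrite /s ge_min lexx orbT.
exists (s ^+ 2); first by rewrite exprn_gt0.
move=> B rB; set t := law B true => ht.
have lf : law B false = 1 - t.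
  by have := law_sum1 rB; rewrite big_bool /= -/t; lra.
rewrite /H big_bool /= !xlnxE lf -/t.
have t0 : 0 <= t by apply: law_ge0.
have t1 : t < 1 by apply: le_lt_trans ht _; nra.
have h1 : - (t * ln t) <= 2 * s.
  move: t0; rewrite le_eqVlt => /orP[/eqP <-|t0]; first by rewrite mul0r; lra.
  have -> : - (t * ln t) = t * (ln (s / t) + ln s^-1).
    by rewrite ln_div ?posrE // lnV ?posrE //; ring.
  have l1 := ln_leB1 (divr_gt0 s0 t0).
  have l2 : ln s^-1 <= s^-1 - 1 by apply: ln_leB1; rewrite invr_gt0.
  apply: le_trans (_ : t * ((s / t - 1) + (s^-1 - 1)) <= _).
    by rewrite ler_pM2l //; lra.
  have -> : t * ((s / t - 1) + (s^-1 - 1)) = s + t / s - 2 * t.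
    by field; rewrite !gt_eqF.
  have : t / s <= s by rewrite ler_pdivrMr // -expr2.
  by lra.
have h2 : - ((1 - t) * ln (1 - t)) <= t.
  have u0 : 0 < 1 - t by rewrite subr_gt0.
  rewrite -mulrN -lnV ?posrE //.
  have l1 : ln (1 - t)^-1 <= (1 - t)^-1 - 1 by apply: ln_leB1; rewrite invr_gt0.
  apply: le_trans (_ : (1 - t) * ((1 - t)^-1 - 1) <= _).
    by rewrite ler_pM2l.
  by rewrite mulrBr divff ?gt_eqF // mulr1; lra.
have : s ^+ 2 <= s by nra.
by lra.
Qed.

(** Given [Z], the bit [Q] is recovered from the error bit [Q w (+) g (Z w)]. *)
Lemma CH_approx (B : finType) (Q : Om -> bool) (Z : Om -> B) (g : B -> bool) :
  rv Q -> rv Z -> CH Q Z <= H (fun w => Q w (+) g (Z w)).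
Proof.
move=> rQ rZ; have rD : rv (fun w => Q w (+) g (Z w)).
  apply: (rv_det (rv_rpair rQ rZ)) => w w' /rpairP[-> ->] //.
apply: le_trans (CH_leH rD rZ); apply: CH_le => // w w' /rpairP[h1 h2].
by rewrite -(addbK (g (Z w)) (Q w)) h1 h2 addbK.
Qed.

End Information.

(** * Entropy of processes *)

Lemma le0_of_linear_bound (R : realType) (a c : R) :
  (forall N : nat, N%:R * a <= c) -> a <= 0.
Proof.
move=> h; rewrite leNgt; apply/negP => a0.
have := h (Num.truncn (c / a)).+1; rewrite leNgt => /negP; apply.
by rewrite -ltr_pdivrMr // truncnS_gt.
Qed.

Section Dynamics.
Variables (R : realType) (Om : Type) (C : content R Om) (T : Om -> Om).
Local Notation H := (H C).
Local Notation CH := (CH C).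
Local Notation law := (law C).
Local Notation rv := (rv C).

Definition invariant_content :=
  forall A, ev C A -> ev C (T @^-1` A) /\ pr C (T @^-1` A) = pr C A.

Hypothesis invT : invariant_content.

Definition it (A : Type) (X : Om -> A) i : Om -> A := fun w => X (iter i T w).
Definition blk (A : Type) (X : Om -> A) a n : Om -> n.-tuple A :=
  tup (fun i => it X (a + i)) n.

Lemma rv_it (A : finType) (X : Om -> A) i : rv X -> rv (it X i).
Proof.
move=> rX; elim: i => [//|i IH] a; have [h _] := invT (IH a).
rewrite (_ : _ @^-1` _ = T @^-1` (it X i @^-1` [set a])) //.
by apply/seteqP; split => w /=; rewrite /it iterSr.
Qed.

Lemma law_it (A : finType) (X : Om -> A) i a : rv X -> law (it X i) a = law X a.
Proof.
move=> rX; elim: i => [//|i <-]; have [_ e] := invT (rv_it i rX a).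
rewrite /law -e; congr (pr C _).
by apply/seteqP; split => w /=; rewrite /it iterSr.
Qed.

Lemma H_it (A : finType) (X : Om -> A) i : rv X -> H (it X i) = H X.
Proof.
by move=> rX; rewrite /H; congr (- _); apply: eq_bigr => a _; rewrite law_it.
Qed.

Lemma CH_it (A B : finType) (X : Om -> A) (Y : Om -> B) i : rv X -> rv Y ->
  CH (it X i) (it Y i) = CH X Y.
Proof.
move=> rX rY; rewrite /CH (H_it i rY).
by rewrite (_ : rpair _ _ = it (rpair X Y) i) // H_it //; apply: rv_rpair.
Qed.

Lemma rv_blk (A : finType) (X : Om -> A) a n : rv X -> rv (blk X a n).
Proof. by move=> rX; apply: rv_tup => i; apply: rv_it. Qed.

Lemma it_blk (A : Type) (X : Om -> A) a n i : it (blk X a n) i = blk X (a + i) n.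
Proof.
apply/funext => w; apply: eq_from_tnth => j; rewrite !tnth_mktuple /it.
by rewrite -iterD addnAC.
Qed.

Lemma blkP (A : Type) (X : Om -> A) a n w w' : blk X a n w = blk X a n w' <->
  forall i, (a <= i < a + n)%N -> it X i w = it X i w'.
Proof.
rewrite tupP; split => h i.
  case/andP => h1 h2; have := h (i - a)%N; rewrite subnKC //; apply; lia.
by move=> ilt; apply: h; lia.
Qed.

Lemma H_blk (A : finType) (X : Om -> A) a n : rv X -> H (blk X a n) = H (blk X 0 n).
Proof.
by move=> rX; rewrite -[a]add0n -it_blk H_it //; apply: rv_blk.
Qed.

Lemma det_blk (A : Type) (X : Om -> A) a n b m : (a <= b)%N -> (b + m <= a + n)%N ->
  det (blk X a n) (blk X b m).
Proof.
by move=> h1 h2 w w' /blkP h; apply/blkP => i hi; apply: h; lia.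
Qed.

Section Increments.
Variables (K : finType) (P : Om -> K).
Hypothesis rP : rv P.
Let Hn n := H (blk P 0 n).
Let d n := Hn n.+1 - Hn n.

(** Stationarity moves the shorter block to start at 1; monotonicity of the increments then follows
    from that of conditional entropy. *)
Lemma incrE n : d n = CH P (blk P 1 n).
Proof.
rewrite /d /Hn -(@H_blk _ P 1 n) // /CH; congr (_ - _).
apply: H_eq; first exact: rv_blk.
  move=> w w' /blkP h; apply/rpairP; split; first by apply: (h 0%N).
  by apply/blkP => i hi; apply: h; lia.
move=> w w' /rpairP[h1 /blkP h2]; apply/blkP => -[|i] hi; first exact: h1.
by apply: h2; lia.
Qed.

Lemma incr_ge0 n : 0 <= d n.
Proof. by rewrite incrE CH_ge0 //; apply: rv_blk. Qed.

Lemma incr_le m n : (m <= n)%N -> d n <= d m.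
Proof.
move=> mn; rewrite !incrE; apply: CH_cond_le => //; first exact: rv_blk.
by apply: det_blk; lia.
Qed.

Lemma block_entropy_le k n : Hn (k + n) <= Hn k + n%:R * d k.
Proof.
elim: n => [|n IH]; first by rewrite addn0 mul0r addr0.
have := incr_le (leq_addr n k); rewrite {1}/d addnS -[n.+1]addn1 natrD; lra.
Qed.

Lemma block_entropy_ge h k n : (forall i, h <= d i) -> n%:R * h <= Hn (k + n) - Hn k.
Proof.
move=> hd; elim: n => [|n IH]; first by rewrite addn0 mul0r subrr.
have := hd (k + n)%N; rewrite /d addnS -[n.+1]addn1 natrD; lra.
Qed.

End Increments.

Lemma sum_ord_const_le n (f : 'I_n -> R) (c : R) :
  (forall i, f i <= c) -> \sum_(i < n) f i <= n%:R * c.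
Proof.
move=> h; apply: le_trans (ler_sum _ (fun i _ => h i)) _.
by rewrite sumr_const card_ord mulr_natl.
Qed.

(* The Rokhlin-Sinai argument: if [Q] is asymptotically a function of the remote
   future of [P], then [h(P v Q) = h(P)] while also [h(P v Q) = h(P) + h(Q)]. *)
Lemma zero_entropy_of_tail (K : finType) (P : Om -> K) (Q : Om -> bool) :
  rv P -> rv Q ->
  (forall n e, 0 < e -> exists m, CH Q (blk P n m) <= e) ->
  forall e, 0 < e -> exists c, forall N : nat, H (blk Q 0 N) <= c + e * N%:R.
Proof.
(* One third per loss: the increment at [k] over the rate [h], the entropy of [Q] given the next [k]
   values of [P], and its entropy given the remote future of [P]. *)
move=> rP rQ tailQ e e0; pose e' := e / 3.
have e'0 : 0 < e' by rewrite divr_gt0.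
pose Hn n := H (blk P 0 n); pose d n := Hn n.+1 - Hn n.
pose h := inf (range d).
have lbd : has_inf (range d).
  split; first by exists (d 0%N), 0%N.
  by exists 0 => _ [n _ <-]; apply: incr_ge0.
have hd i : h <= d i by apply: ge_inf; [case: lbd|exists i].
have [_ [K1 _ <-] dK1] := inf_adherent e'0 lbd.
have [K2 hK2] := tailQ 0%N e' e'0.
pose k := maxn K1 K2.
have dk : d k <= h + e'.
  by apply: le_trans (ltW dK1); apply: incr_le => //; apply: leq_maxl.
have hk : CH Q (blk P 0 k) <= e'.
  apply: le_trans hK2; apply: CH_cond_le => //; first exact: rv_blk.
  by apply: det_blk => //; rewrite !add0n leq_maxr.
exists (Hn k) => N.
(* The extra length [N] absorbs the shifts by [i < N] that bring each [it Q i] back to time 0. *)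
have [M' hM'] := tailQ N e' e'0; pose M := (N + M')%N.
have rX a n : rv (blk P a n) by apply: rv_blk.
have rQN : rv (blk Q 0 N) by apply: rv_blk.
have h1 : CH (blk Q 0 N) (blk P N M) <= N%:R * e'.
  apply: le_trans (CH_tup N _ (rX N M)) _; first by move=> i; apply: rv_it.
  apply: sum_ord_const_le => i; rewrite add0n.
  rewrite (_ : blk P N M = it (blk P (N - i) M) i); last first.
    by rewrite it_blk subnK // ltnW.
  rewrite CH_it //; apply: le_trans hM'; apply: CH_cond_le => //.
  by apply: det_blk; rewrite ?leq_subr // /M; have := ltn_ord i; lia.
have h2 : N%:R * h <= CH (blk P 0 N) (blk P N M).
  rewrite /CH (@H_blk _ P N) // (@H_eq _ _ _ _ _ _ (blk P 0 (M + N))).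
  - by apply: block_entropy_ge; exact: hd.
  - exact: rv_rpair.
  - move=> w w' /rpairP[/blkP k1 /blkP k2]; apply/blkP => i hi.
    by have [iN|Ni] := ltnP i N; [apply: k1|apply: k2]; lia.
  - by move=> w w' k1; apply/rpairP; split; apply: det_blk k1; lia.
(* For the blocks of length [N] and the later block F of [P]: H(P|Q) >= H(P|Q,F) >= H(P|F) - H(Q|F).
   By [h1] and [h2], conditioning on [Q] leaves [P] almost its full entropy rate. *)
have h3 : CH (blk P 0 N) (blk P N M) - CH (blk Q 0 N) (blk P N M) <=
    CH (blk P 0 N) (blk Q 0 N).
  apply: le_trans (_ : CH (blk P 0 N) (rpair (blk Q 0 N) (blk P N M)) <= _).
    rewrite lerBlDr -CH_chain //; apply: CH_le => //; first exact: rv_rpair.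
    by move=> w w' /rpairP[/rpairP[]].
  apply: CH_cond_le => //; first exact: rv_rpair.
  by move=> w w' /rpairP[].
have h4 : H (rpair (blk P 0 N) (blk Q 0 N)) <=
    CH (blk Q 0 N) (blk P 0 (k + N)) + Hn (k + N)%N.
  rewrite /CH subrK; apply: H_le; first exact: rv_rpair.
  move=> w w' /rpairP[k1 k2]; apply/rpairP; split => //.
  by apply: det_blk k2; lia.
have h5 : CH (blk Q 0 N) (blk P 0 (k + N)) <= N%:R * e'.
  apply: le_trans (CH_tup N _ (rX 0%N _)) _; first by move=> i; apply: rv_it.
  apply: sum_ord_const_le => i; rewrite add0n.
  apply: le_trans (_ : CH (it Q i) (blk P i k) <= _).
    apply: CH_cond_le => //; first exact: rv_it.
    by apply: det_blk; have := ltn_ord i; lia.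
  by rewrite -{2}[i : nat]add0n -it_blk CH_it.
have h6 : Hn (k + N)%N <= Hn k + N%:R * d k by exact: block_entropy_le.
have N0 : 0 <= N%:R :> R by [].
have h7 : N%:R * d k <= N%:R * h + N%:R * e' by rewrite -mulrDr ler_wpM2l.
have -> : e = 3 * e' by rewrite /e'; field.
have h8 : CH (blk P 0 N) (blk Q 0 N) =
    H (rpair (blk P 0 N) (blk Q 0 N)) - H (blk Q 0 N) by [].
move: h3 h4; rewrite h8.
by lra.
Qed.

(** Copies of [P] spaced by [n] are nearly independent, so [N] of them carry about [N * H P], while
    [Y] over the same time carries o(N). Hence conditioning on [Y] hardly lowers the average entropy
    of a copy, and a fortiori conditioning each copy on its own block of length [l]. *)
Lemma disjoint_zero_entropy (K B : finType) (P : Om -> K) (Y : Om -> B) :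
  rv P -> rv Y ->
  (forall e, 0 < e -> exists n, forall m, H P - e <= CH P (blk P n m)) ->
  (forall e, 0 < e -> exists c, forall N : nat, H (blk Y 0 N) <= c + e * N%:R) ->
  forall l a b, law (rpair P (blk Y 0 l)) (a, b) = law P a * law (blk Y 0 l) b.
Proof.
move=> rP rY mixP zY l a b; apply: indep_of_entropy => //; first exact: rv_blk.
suff : H P <= CH P (blk Y 0 l) by rewrite /CH; lra.
apply/ler_addgt0Pr => e e0; pose e2 := e / 2.
have e20 : 0 < e2 by rewrite divr_gt0.
have [n hn] := mixP e2 e20.
(* [Y] is observed for about [n * N] times against [N] copies of [P]; the successor covers
   [n = 0]. *)
pose e1 := e2 / n.+1%:R; have e10 : 0 < e1 by rewrite divr_gt0.
have [c hc] := zY e1 e10.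
pose X N := tup (fun i => it P (n * i)) N.
have rX N : rv (X N) by apply: rv_tup => i; apply: rv_it.
have HX N : N%:R * (H P - e2) <= H (X N).
  elim: N => [|N IH]; first by rewrite mul0r H_ge0.
  have -> : H (X N.+1) = CH P (it (X N) n) + H (X N).
    rewrite /CH H_it // subrK; apply: H_eq => //.
      move=> w w' /tupP h; apply/rpairP; split.
        by have := h 0%N isT; rewrite muln0.
      apply/tupP => i iN; have := h i.+1 iN.
      by rewrite /it -!iterD mulnS addnC.
    move=> w w' /rpairP[h1 /tupP h2]; apply/tupP => -[|i] hi.
      by rewrite muln0.
    by have := h2 i hi; rewrite /it -!iterD mulnS addnC.
  rewrite -[N.+1]addn1 natrD mulrDl mul1r addrC lerD //.
  apply: le_trans (hn (n * N).+1) _; apply: CH_cond_le => //; first exact: rv_blk.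
  move=> w w' /blkP h; apply/tupP => i iN; rewrite /it -!iterD.
  have : (n * i <= n * N)%N by rewrite leq_mul2l ltnW ?orbT.
  by move=> ?; apply: h; lia.
have HXY N : H (X N) <= N%:R * CH P (blk Y 0 l) + H (blk Y 0 (n * N + l)).
  have rYN : rv (blk Y 0 (n * N + l)) by apply: rv_blk.
  apply: le_trans (_ : CH (X N) (blk Y 0 (n * N + l)) +
    H (blk Y 0 (n * N + l)) <= _).
    rewrite /CH subrK; apply: H_le; first exact: rv_rpair.
    by move=> w w' /rpairP[].
  rewrite lerD2r; apply: le_trans (CH_tup N _ rYN) _.
    by move=> i; apply: rv_it.
  apply: sum_ord_const_le => i.
  apply: le_trans (_ : CH (it P (n * i)) (blk Y (n * i) l) <= _).
    apply: CH_cond_le => //; first exact: rv_it.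
    apply: det_blk => //.
    have : (n * i <= n * N)%N by rewrite leq_mul2l (ltnW (ltn_ord i)) orbT.
    by lia.
  by rewrite -{2}[(n * i)%N]add0n -it_blk CH_it //; apply: rv_blk.
have : H P - e - CH P (blk Y 0 l) <= 0; last by lra.
apply: (@le0_of_linear_bound _ _ (c + e1 * l%:R)) => N.
have k1 := HX N; have k2 := HXY N; have k3 := hc (n * N + l)%N.
have k4 : e1 * (n * N)%:R <= N%:R * e2.
  rewrite natrM mulrA mulrC ler_wpM2l // /e1 -mulrA.
  rewrite ler_piMr //; first exact: ltW.
  by rewrite mulrC ler_pdivrMr // mul1r ler_nat.
have -> : e = 2 * e2 by rewrite /e2; field.
rewrite natrD mulrDr in k3; rewrite mulrBr in k1.
by lra.
Qed.

End Dynamics.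

(** * Completely positive entropy implies mixing with the remote future *)

Section ProbContent.
Context {R : realType} {d : measure_display} {Om : measurableType d}.
Variable mu : probability Om R.
Local Notation pm A := (fine (mu A)).

Let fmu (A : set Om) : measurable A -> mu A \is a fin_num.
Proof. by move=> mA; apply: fin_num_measure. Qed.

Let pm_ge0 A : measurable A -> 0 <= pm A.
Proof. by move=> _; apply: fine_ge0. Qed.

Let pmT : pm setT = 1.
Proof. by rewrite probability_setT. Qed.

Let pmU A B : measurable A -> measurable B -> A `&` B = set0 ->
  pm (A `|` B) = pm A + pm B.
Proof. by move=> mA mB AB0; rewrite measureU // fineD //; apply: fmu. Qed.

Definition prob_content : content R Om :=
  Content measurableT (@measurableC _ _) (@measurableI _ _) pm_ge0 pmT pmU.

Lemma prob_contentE A : measurable A -> mu A = (pr prob_content A)%:E.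
Proof. by move=> mA; rewrite fineK // fmu. Qed.

Lemma prob_content_bigcup (F : nat -> set Om) (e : R) :
  (forall i, measurable (F i)) -> 0 <= e ->
  (forall i, pr prob_content (F i) <= e / (2 ^ i.+1)%:R) ->
  pr prob_content (\bigcup_i F i) <= e.
Proof.
move=> mF e0 hF; have mU : measurable (\bigcup_i F i) by exact: bigcup_measurable.
rewrite -lee_fin -prob_contentE //.
apply: le_trans (measure_sigma_subadditive _ mF mU (@subset_refl _ _)) _.
apply: le_trans (epsilon_trick0 xpredT e0).
apply: lee_nneseries => [i _ _|i _]; first exact: measure_ge0.
by have := hF i; rewrite -lee_fin -prob_contentE //.
Qed.

End ProbContent.

Lemma pigeonhole_content (R : realType) (Om : Type) (C : content R Om) (J : nat)
    (F : 'I_J -> set Om) :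
  (0 < J)%N -> (forall i, ev C (F i)) ->
  (forall i j, i != j -> F i `&` F j = set0) -> exists j, pr C (F j) <= J%:R^-1.
Proof.
move=> J0 EF dF; apply: contrapT => h.
have hlt j : J%:R^-1 < pr C (F j).
  by rewrite ltNge; apply/negP => hj; apply: h; exists j.
have := pr_le1 (ev_big predT EF); rewrite pr_big // leNgt => /negP; apply.
have -> : 1 = \sum_(j < J) J%:R^-1 :> R.
  by rewrite sumr_const card_ord -[_ *+ J]mulr_natr mulVf // pnatr_eq0 -lt0n.
by apply: ltr_sum => //; apply/hasP; exists (Ordinal J0); rewrite ?mem_index_enum.
Qed.

Lemma half_pow_small (R : realType) (c e : R) : 0 < e ->
  exists k0, forall k, (k0 <= k)%N -> c * 2^-1 ^+ k <= e.
Proof.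
move=> e0; exists (Num.truncn (c / e)).+1 => k hk.
rewrite exprVn ler_pdivrMr ?exprn_gt0 // mulrC -ler_pdivrMr //.
apply: le_trans (ltW (truncnS_gt _)) _.
by rewrite -natrX ler_nat; apply: leq_trans hk _; apply: ltnW; apply: ltn_expl.
Qed.

Section ConditionalSpread.
Variables (R : realType) (Om : Type) (C : content R Om).
Variables (E : set Om) (A : finType) (X : Om -> A) (l d : R).
Hypotheses (EE : ev C E) (rX : rv C X) (hV : pr C E ^+ 2 + d <= V C E X).
Let p := pr C E.

Let cm_sq z : (cm C E X z - p) ^+ 2 <= `|cm C E X z - p|.
Proof.
rewrite -real_normK ?num_real // expr2 ler_piMr // ler_norml.
have := cm_ge0 z EE rX; have := cm_le1 z EE rX.
have := pr_ge0 EE; have := pr_le1 EE; rewrite -/p; lra.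
Qed.

Let sum_shift (c : R) (u : A -> R) :
  \sum_z law C X z * (2 * u z + c * (cm C E X z - p)) =
  2 * \sum_z law C X z * u z.
Proof.
transitivity (2 * (\sum_z law C X z * u z) +
    (c * (\sum_z law C X z * cm C E X z) - c * p * (\sum_z law C X z))).
  rewrite !mulr_sumr -sumrB -big_split /=; apply: eq_bigr => z _; ring.
by rewrite sum_law_cm // law_sum1 // /p; ring.
Qed.

Lemma upper_level_large : p <= l ->
  d <= 2 * (pr C [set w | l < cm C E X (X w)] + (l - p)).
Proof.
move=> pl; apply: le_trans (_ : \sum_z law C X z * (cm C E X z - p) ^+ 2 <= _).
  by rewrite V_cst //; move: hV; rewrite -/p; lra.
rewrite (pr_pred (fun a => l < cm C E X a)) //.
(* With [x = cm - p], which integrates to 0, [|x| + x] is twice the positive part of [x]. *)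
apply: le_trans (_ : \sum_z law C X z * (2 * ((l < cm C E X z)%R%:R + (l - p)) +
   (- 1) * (cm C E X z - p)) <= _).
  apply: ler_sum => z _; rewrite ler_wpM2l ?law_ge0 //.
  apply: le_trans (cm_sq z) _; rewrite ler_norml.
  have := cm_le1 z EE rX; have := pr_ge0 EE; rewrite -/p.
  by case: ltP => /= ?; lra.
rewrite sum_shift ler_pM2l // le_eqVlt; apply/orP; left; apply/eqP.
transitivity (\sum_z (law C X z * (l < cm C E X z)%R%:R + (l - p) * law C X z)).
  by apply: eq_bigr => z _; ring.
rewrite big_split /= -mulr_sumr law_sum1 // mulr1; congr (_ + _).
rewrite [RHS]big_mkcond; apply: eq_bigr => z _.
by case: ltP => _; rewrite ?mulr1 ?mulr0.
Qed.

Lemma lower_level_large : p <= l ->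
  d <= 2 * (1 - pr C [set w | l < cm C E X (X w)]).
Proof.
move=> pl; apply: le_trans (_ : \sum_z law C X z * (cm C E X z - p) ^+ 2 <= _).
  by rewrite V_cst //; move: hV; rewrite -/p; lra.
rewrite (pr_pred (fun a => l < cm C E X a)) //.
(* Here [|x| - x], twice the negative part, vanishes above [l] since [p <= l]. *)
apply: le_trans (_ : \sum_z law C X z * (2 * (1 - (l < cm C E X z)%R%:R) +
   1 * (cm C E X z - p)) <= _).
  apply: ler_sum => z _; rewrite ler_wpM2l ?law_ge0 //.
  apply: le_trans (cm_sq z) _; rewrite ler_norml.
  have := cm_ge0 z EE rX; have := pr_le1 EE; rewrite -/p.
  by case: ltP => /= ?; lra.
rewrite sum_shift ler_pM2l // le_eqVlt; apply/orP; left; apply/eqP.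
transitivity (\sum_z (law C X z - law C X z * (l < cm C E X z)%R%:R)).
  by apply: eq_bigr => z _; ring.
rewrite sumrB law_sum1 //; congr (_ - _).
rewrite [RHS]big_mkcond; apply: eq_bigr => z _.
by case: ltP => _; rewrite ?mulr1 ?mulr0.
Qed.

End ConditionalSpread.

(** Cut the current interval into [2 ^ k.+1] cells of width [wd k.+1]; by pigeonhole [f k.+1] meets
    one of them with probability at most [2^-1 ^+ k.+1], and its lower end is the next level.
    Nesting keeps successive levels comparable, and each [f k] rarely lies just above its own
    level. *)
Lemma nested_thresholds (R : realType) (Om : Type) (C : content R Om)
    (f : nat -> Om -> R) (wd : nat -> R) (p : R) :
  (forall k a b, ev C [set w | a < f k w <= b]) ->
  (forall k, 0 < wd k) ->
  (forall k, wd k.+1 = wd k * 2^-1 ^+ k.+1) ->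
  exists l : nat -> R, [/\ l 0%N = p,
    (forall k, l k <= l k.+1),
    (forall k, l k.+1 + wd k.+1 <= l k + wd k) &
    (forall k, pr C [set w | l k < f k w <= l k + wd k] <= 2^-1 ^+ k)].
Proof.
move=> evf wd0 wdS.
have step k a : exists b, [/\ a <= b, b + wd k.+1 <= a + wd k &
    pr C [set w | b < f k.+1 w <= b + wd k.+1] <= 2^-1 ^+ k.+1].
  pose J := (2 ^ k.+1)%N; pose u := wd k.+1.
  have J0 : (0 < J)%N by rewrite expn_gt0.
  have wdE : wd k = J%:R * u.
    rewrite /u wdS mulrCA /J natrX -exprMn divff ?pnatr_eq0 //.
    by rewrite expr1n mulr1.
  pose F (j : 'I_J) := [set w | a + j%:R * u < f k.+1 w <= a + j%:R * u + u].
  have u0 : 0 < u by apply: wd0.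
  have dF i j : i != j -> F i `&` F j = set0.
    wlog ij : i j / (i < j)%N.
      move=> wl ne; have := ne; rewrite -val_eqE neq_ltn => /orP[] h.
        exact: wl.
      by rewrite setIC; apply: wl => //; rewrite eq_sym.
    move=> _; rewrite -subset0 => w [/andP[_ h1] /andP[h2 _]].
    have := lt_le_trans h2 h1; rewrite ltNge => /negP; apply.
    have : i.+1%:R * u <= j%:R * u by rewrite ler_pM2r // ler_nat.
    by rewrite -natr1 mulrDl mul1r; lra.
  have [j hj] := pigeonhole_content J0 (fun j => evf k.+1 _ _) dF.
  exists (a + j%:R * u); split.
  - by rewrite lerDl mulr_ge0 // ltW.
  - have : j.+1%:R * u <= J%:R * u by rewrite ler_pM2r // ler_nat.
    by rewrite -natr1 mulrDl mul1r -/u wdE; lra.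
  - by rewrite exprVn -natrX.
pose g k := projT1 (choice (step k)).
have hg k a := projT2 (choice (step k)) a.
pose fix l k := if k is k'.+1 then g k' (l k') else p.
exists l; split => // k.
- by have [] := hg k (l k).
- by have [] := hg k (l k).
- case: k => [|k]; last by have [] := hg k (l k).
  by rewrite expr0; apply: pr_le1; apply: evf.
Qed.

(** A Borel-Cantelli argument: off the union of the [D (k + j)] the events are constant from [k] on,
    and the geometric series sums to [2 * c * 2^-1 ^+ k]. The limit is taken as the upper limit of
    the [A k], which is measurable. *)
Lemma limit_event (R : realType) (d : measure_display) (Om : measurableType d)
    (mu : probability Om R) (A D : nat -> set Om) (c : R) :
  (forall k, measurable (A k)) -> (forall k, measurable (D k)) -> 0 <= c ->
  (forall k w, ~ D k w -> (A k w <-> A k.+1 w)) ->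
  (forall k, pr (prob_content mu) (D k) <= c * 2^-1 ^+ k) ->
  exists2 B, measurable B & forall k, exists U, [/\ measurable U,
    pr (prob_content mu) U <= 2 * c * 2^-1 ^+ k &
    forall w, ~ U w -> (B w <-> A k w)].
Proof.
move=> mA mD c0 AD prD.
exists (\bigcap_n \bigcup_k A (n + k)%N).
  by apply: bigcapT_measurable => n; apply: bigcup_measurable.
move=> k; exists (\bigcup_j D (k + j)%N); split.
- exact: bigcup_measurable.
- apply: prob_content_bigcup => //.
    by rewrite !mulr_ge0 // exprn_ge0 // invr_ge0.
  move=> i; apply: le_trans (prD _) _.
  by rewrite le_eqVlt natrX exprD !exprVn !exprS; apply/orP; left; apply/eqP; field;
    rewrite !expf_neq0 //= pnatr_eq0.
move=> w nU.
have Ak j : A k w <-> A (k + j)%N w.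
  elim: j => [|j ->]; first by rewrite addn0.
  by rewrite addnS; apply: AD => Dw; apply: nU; exists j.
split=> [|Akw n _]; first by move=> /(_ k I)[j _ /Ak].
by exists k => //; rewrite addnC; apply/Ak.
Qed.

Section Mixing.
Context {R : realType} {d : measure_display} {Om : measurableType d}.
Variables (mu : probability Om R) (T : Om -> Om).
Local Notation C := (prob_content mu).
Hypothesis invT : invariant_content C T.

(** The supremum over block lengths decreases with the starting time; its infimum [v] plays the part
    of the squared norm of the conditional expectation of [E] on the tail. The last clause controls
    any block containing two late ones, as [cm_close] requires. *)
Lemma V_remote_limit (E : set Om) (K : finType) (P : Om -> K) (b : R) :
  measurable E -> rv C P -> (forall n, exists m, b < V C E (blk T P n m)) ->
  exists2 v, b <= v & forall e k, 0 < e -> exists n m, [/\ (k <= n)%N,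
    v - e <= V C E (blk T P n m) &
    forall n' m', (n <= n')%N -> V C E (blk T P n' m') <= v + e].
Proof.
move=> mE rP hb.
pose w n := sup (range (fun m => V C E (blk T P n m))).
have supw n : has_sup (range (fun m => V C E (blk T P n m))).
  split; first by exists (V C E (blk T P n 0)), 0%N.
  by exists 1 => _ [m _ <-]; apply: V_le1 => //; apply: rv_blk.
have Vw n m : V C E (blk T P n m) <= w n.
  by apply: ub_le_sup; [case: (supw n)|exists m].
have bw n : b <= w n by have [m /ltW h] := hb n; apply: le_trans h (Vw n m).
have infw : has_inf (range w).
  by split; [exists (w 0%N), 0%N|exists b => _ [n _ <-]].
exists (inf (range w)); first by apply: lb_le_inf; [case: infw|move=> _ [n _ <-]].
move=> e k e0; have [_ [n0 _ <-] hn0] := inf_adherent e0 infw.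
have wle n n' : (n <= n')%N -> w n' <= w n.
  move=> nn'; apply: sup_le_ub; first by case: (supw n').
  move=> _ [m _ <-]; apply: le_trans (Vw n (n' + m - n)%N).
  by apply: V_le => //; [exact: rv_blk|apply: det_blk; lia].
exists (maxn n0 k).
have [_ [m _ <-] hm] := sup_adherent e0 (supw (maxn n0 k)).
exists m; split; first exact: leq_maxr.
  apply: le_trans (ltW hm); rewrite lerD2r.
  by apply: ge_inf; [case: infw|exists (maxn n0 k)].
move=> n' m' hn'; apply: le_trans (ltW hn0); apply: le_trans (Vw n' m') _.
by apply: wle; apply: leq_trans hn'; apply: leq_maxl.
Qed.

Hypothesis cpe : forall Q : Om -> bool, rv C Q ->
  (forall e, 0 < e -> exists c, forall N : nat, H C (blk T Q 0 N) <= c + e * N%:R) ->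
  law C Q true = 0 \/ law C Q true = 1.

(* If the remote future of [P] kept information on [E], thresholding the conditional
   probabilities of [E] at suitable levels would give a Cauchy sequence of events whose
   limit is a nontrivial tail event of [P]; such an event has zero entropy. *)
Lemma cpe_mixing (E : set Om) (K : finType) (P : Om -> K) (e : R) :
  measurable E -> rv C P -> 0 < e ->
  exists n, forall m, V C E (blk T P n m) <= pr C E ^+ 2 + e.
Proof.
move=> mE' rP e0; apply: contrapT => nex; have mE : ev C E := mE'.
have hb n : exists m, pr C E ^+ 2 + e < V C E (blk T P n m).
  apply: contrapT => h; apply: nex; exists n => m.
  by rewrite leNgt; apply/negP => hm; apply: h; exists m.
have rB n m : rv C (blk T P n m) by apply: rv_blk.
have e1 : e <= 1.
  have [m hm] := hb 0%N; have := V_le1 mE (rB 0%N m).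
  by have := sqr_ge0 (pr C E); lra.
have [v pv hv] := V_remote_limit mE rP hb.
(* Starting at [e / 8] keeps the levels within [e / 8] of [pr C E]; with the excess [e / 2] of [hV],
   each [A k] below has probability between [e / 8] and [1 - e / 4]. *)
pose wd := fix wd k := if k is k'.+1 then wd k' * 2^-1 ^+ k'.+1 else e / 8 : R.
have hp k : 0 < 2^-1 ^+ k :> R by rewrite exprn_gt0.
have hp1 k : 2^-1 ^+ k <= 1 :> R by rewrite exprn_ile1 ?invf_le1 ?ler1n ?invr_ge0.
have wd0 k : 0 < wd k by elim: k => [|k IH] /=; rewrite ?divr_gt0 // mulr_gt0.
have wdle k : wd k.+1 <= wd k by rewrite /= ler_piMr // ltW.
have wde k : wd k <= e / 8 by elim: k => [//|k]; apply: le_trans; exact: wdle.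
have wdS k : wd k.+1 = wd k * 2^-1 ^+ k.+1 by [].
clearbody wd.
(* Chosen so that the bound from [cm_close], at most [8 * ep k / wd k.+1 ^+ 2], comes to
   [2^-1 ^+ k]. *)
pose ep k := 2^-1 ^+ k * wd k.+1 ^+ 2 / 8.
have ep0 k : 0 < ep k by rewrite divr_gt0 // mulr_gt0 // exprn_gt0.
have eple k : ep k.+1 <= ep k.
  rewrite /ep ler_pM2r // ler_pM ?exprn_ge0 ?(ltW (wd0 _)) //.
    by rewrite exprS ler_piMl ?ltW ?invf_lt1 ?ltr1n.
  by rewrite ler_pXn2r ?nnegrE ?(ltW (wd0 _)).
have epe k : ep k <= e / 2.
  have h1 := wde k.+1; have h2 := wd0 k.+1.
  have h3 : wd k.+1 ^+ 2 <= e by rewrite expr2; nra.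
  have h4 : 2^-1 ^+ k * wd k.+1 ^+ 2 <= wd k.+1 ^+ 2.
    by rewrite ler_piMl // sqr_ge0.
  by rewrite /ep; lra.
have [n hn] := choice (fun k => hv (ep k) k (ep0 k)).
have {hn} [m hnm] := choice hn.
pose X k := blk T P (n k) (m k).
pose f k w := cm C E (X k) (X k w).
have evf k a b : ev C [set w | a < f k w <= b].
  exact: (ev_pred (fun z => a < cm C E (X k) z <= b) (rB _ _)).
have [l [l0 lS lw lp]] := nested_thresholds (pr C E) evf wd0 wdS.
have pl k : pr C E <= l k by elim: k => [|k h]; rewrite ?l0 // (le_trans h).
have lub k : l k - pr C E <= e / 8.
  have : l k + wd k <= pr C E + e / 8.
    by elim: k => [|k h]; [rewrite l0 lerD2l|exact: le_trans h].
  by have := wd0 k; lra.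
pose A k := [set w | l k < f k w].
have mA k : ev C (A k).
  exact: (ev_pred (fun z => l k < cm C E (X k) z) (rB _ _)).
pose G k := [set w | wd k.+1 <= `|f k w - f k.+1 w|].
have mG k : ev C (G k).
  exact: (ev_pred (fun z => wd k.+1 <= `|cm C E (X k) z.1 - cm C E (X k.+1) z.2|)
    (rv_rpair (rB _ _) (rB _ _))).
(* Off [D k] the two conditional probabilities differ by less than [wd k.+1] and neither lies just
   above its level, so both fall on the same side of their levels. *)
pose D k := [set w | l k < f k w <= l k + wd k] `|`
  [set w | l k.+1 < f k.+1 w <= l k.+1 + wd k.+1] `|` G k.
have mD k : ev C (D k) by rewrite /D; do !apply: evU => //; apply: evf.
have AD k w : ~ D k w -> (A k w <-> A k.+1 w).
  move=> /not_orP[/not_orP[/= /negP + /negP] + /negP].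
  rewrite /A /= !negb_and -!leNgt -!ltNge => h1 h2.
  rewrite ltr_norml => /andP[h3 h4].
  have k1 := lS k; have k2 := lw k; have k3 := wd0 k; have k4 := wd0 k.+1.
  by split=> h; move/orP: h1 => [] h1; move/orP: h2 => [] h2; lra.
have prG k : pr C (G k) <= 2^-1 ^+ k.
  have [hk1 hk2 hk3] := hnm k; have [hj1 hj2 hj3] := hnm k.+1.
  (* [W] covers both windows from the earlier start and is still late enough for [V C E W] to be
     close to [v]. *)
  pose a := minn (n k) (n k.+1).
  pose W := blk T P a (n k + m k + n k.+1 + m k.+1)%N.
  have VW : V C E W <= v + ep k.
    rewrite /W /a; case: leqP => h; first exact: hk3.
    by apply: le_trans (hj3 _ _ (leqnn _)) _; rewrite lerD2l.
  have dk : det W (X k) by apply: det_blk; rewrite /a; lia.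
  have dk1 : det W (X k.+1) by apply: det_blk; rewrite /a; lia.
  apply: le_trans (cm_close mE (rB _ _) dk dk1 VW (wd0 k.+1)) _.
  rewrite ler_pdivrMr ?exprn_gt0 //.
  have := eple k; have -> : 2^-1 ^+ k * wd k.+1 ^+ 2 = 8 * ep k.
    by rewrite /ep; field.
  by rewrite -/(X k) -/(X k.+1) in hk2 hj2 *; lra.
have prD k : pr C (D k) <= 3 * 2^-1 ^+ k.
  have mD1 k' := evf k' (l k') (l k' + wd k').
  apply: le_trans (pr_leU (evU (mD1 k) (mD1 k.+1)) (mG k)) _.
  have := pr_leU (mD1 k) (mD1 k.+1).
  have h1 := lp k; have h2 := lp k.+1; have h3 := prG k.
  have : 2^-1 ^+ k.+1 <= 2^-1 ^+ k :> R.
    by rewrite exprS ler_piMl ?ltW ?invf_lt1 ?ltr1n.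
  lra.
have [B mB' hB] := limit_event mA mD (ler0n _ 3) AD prD.
have mB : ev C B := mB'.
pose Q w := `[< B w >].
have preQ : Q @^-1` [set true] = B.
  by apply/seteqP; split => w /=; [move/asboolP|move=> Bw; apply/asboolP].
have rQ : rv C Q.
  case; first by rewrite preQ.
  rewrite (_ : _ @^-1` _ = ~` B); first exact: measurableC.
  apply/seteqP; split => w /=; rewrite /Q; first by move/negbT/asboolP.
  by move=> nB; apply/negbTE/asboolP.
have BA k : `|pr C B - pr C (A k)| <= 6 * 2^-1 ^+ k.
  have [U [mU' prU hU]] := hB k; have mU : ev C U := mU'.
  have h1 : pr C B <= pr C (A k) + pr C U.
    apply: le_trans (pr_leU (mA k) mU); apply: pr_le => //; first exact: evU.
    by move=> w Bw; have [?|/hU h] := pselect (U w); [right|left; apply/h].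
  have h2 : pr C (A k) <= pr C B + pr C U.
    apply: le_trans (pr_leU mB mU); apply: pr_le => //; first exact: evU.
    by move=> w Aw; have [?|/hU h] := pselect (U w); [right|left; apply/h].
  by rewrite ler_norml; move: prU h1 h2; lra.
have hV k : pr C E ^+ 2 + e / 2 <= V C E (X k).
  by have [_ h _] := hnm k; have := epe k; rewrite -/(X k) in h; lra.
have e160 : 0 < e / 16 by rewrite divr_gt0.
have [k1 /(_ k1 (leqnn _)) hk1] := half_pow_small 6 e160.
have lowB : e / 16 <= pr C B.
  have := upper_level_large mE (rB _ _) (hV k1) (pl k1).
  by have := lub k1; have := BA k1; rewrite ler_norml /A /f /X; lra.
have uppB : pr C B <= 1 - e / 16.
  have := lower_level_large mE (rB _ _) (hV k1) (pl k1).
  by have := BA k1; rewrite ler_norml /A /f /X; lra.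
have lawQ : law C Q true = pr C B by rewrite /law preQ.
have : law C Q true = 0 \/ law C Q true = 1; last by rewrite lawQ; lra.
(* [A k] is read off a block starting at [n k >= k], so [Q] is approximated by functions of
   arbitrarily late blocks of [P]. *)
apply: cpe => //; apply: (zero_entropy_of_tail invT rP rQ) => n0 eta eta0.
have [del del0 hdel] := H_bool_small C eta0.
have [k2 hk2] := half_pow_small 6 del0.
pose k := maxn n0 k2.
have [U [mU' prU hU]] := hB k; have mU : ev C U := mU'.
have [nk _ _] := hnm k.
exists (n k + m k)%N.
apply: le_trans (_ : CH C Q (X k) <= _).
  apply: CH_cond_le => //; apply: det_blk.
    by apply: leq_trans nk; apply: leq_maxl.
  by lia.
apply: le_trans (CH_approx (fun z => l k < cm C E (X k) z) rQ (rB _ _)) _.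
have rD : rv C (fun w => Q w (+) (l k < cm C E (X k) (X k w))).
  by apply: (rv_det (rv_rpair rQ (rB (n k) (m k)))) => w w' /rpairP[h1 h2];
    rewrite h1 /X h2.
apply: hdel => //; apply: le_trans (hk2 k (leq_maxr _ _)).
apply: le_trans (_ : pr C U <= _); last by move: prU; lra.
apply: pr_le; [exact: (rD true)|exact: mU|].
move=> w /=; rewrite /Q => hx; apply: contrapT => /hU h; move: hx.
have -> : `[< B w >] = (l k < cm C E (X k) (X k w)).
  by apply/asboolP/idP => /h.
by rewrite addbb.
Qed.

End Mixing.

(** * Densities along an ultrafilter *)

Section ContentConstructions.
Context {R : realType} {Om Om' : Type}.
Variable C : content R Om.
Hypothesis evall : forall A, ev C A.

Section Push.
Variable f : Om -> Om'.
Let q (A : set Om') := pr C (f @^-1` A).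

Let q_ge0 A : setT A -> 0 <= q A. Proof. by move=> _; apply: pr_ge0. Qed.
Let qT : q setT = 1. Proof. by rewrite /q preimage_setT prT. Qed.
Let qU A B : setT A -> setT B -> A `&` B = set0 -> q (A `|` B) = q A + q B.
Proof.
by move=> _ _ AB; rewrite /q preimage_setU prU // -preimage_setI AB preimage_set0.
Qed.

Definition push_content : content R Om' :=
  @Content R Om' setT q I (fun _ _ => I) (fun _ _ _ _ => I) q_ge0 qT qU.
End Push.

Section Cond.
Variable S : set Om.
Hypothesis S0 : 0 < pr C S.
Let q (A : set Om) := pr C (S `&` A) / pr C S.

Let q_ge0 A : setT A -> 0 <= q A.
Proof. by move=> _; rewrite divr_ge0 ?pr_ge0. Qed.
Let qT : q setT = 1. Proof. by rewrite /q setIT divff // gt_eqF. Qed.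
Let qU A B : setT A -> setT B -> A `&` B = set0 -> q (A `|` B) = q A + q B.
Proof.
move=> _ _ AB; rewrite /q setIUr prU // ?mulrDl //.
by rewrite setIACA AB setI0.
Qed.

Definition cond_content : content R Om :=
  @Content R Om setT q I (fun _ _ => I) (fun _ _ _ _ => I) q_ge0 qT qU.
End Cond.
End ContentConstructions.

Definition cnt (E : set nat) (n : nat) : nat := count (fun t => `[< E t >]) (iota 0 n).

Lemma cnt_le E n : (cnt E n <= n)%N.
Proof. by rewrite -[leqRHS](size_iota 0 n) count_size. Qed.

Lemma cntS E n : cnt E n.+1 = (cnt E n + `[< E n >])%N.
Proof. by rewrite /cnt -addn1 iotaD count_cat /= add0n addn0. Qed.

Section NatContent.
Context {R : realType}.
Variable U : set_system nat.
Hypothesis UU : UltraFilter U.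
Hypothesis Uoo : \oo `<=` U.

Definition dens (E : set nat) (n : nat) : R := (cnt E n)%:R / n%:R.

Lemma dens_ge0 E n : 0 <= dens E n.
Proof. by rewrite /dens divr_ge0. Qed.

Lemma dens_le1 E n : dens E n <= 1.
Proof.
rewrite /dens; case: n => [|n]; first by rewrite invr0 mulr0.
by rewrite ler_pdivrMr // mul1r ler_nat cnt_le.
Qed.

Lemma cvg_ultra_of_cvg (T : topologicalType) (u : nat -> T) (l : T) :
  u @ \oo --> l -> u @ U --> l.
Proof. by move=> h A /h; apply: Uoo. Qed.

(** Compactness of the unit interval gives a cluster point, and an ultrafilter converges to its
    cluster points. *)
Lemma dens_cvg E : exists l : R, dens E @ U --> l.
Proof.
have PU := @ultra_proper _ _ UU.
have [p [_ cp]] : exists p : R, (`[0, 1] `&` cluster (dens E @ U)) p.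
  apply: segment_compact; rewrite /fmap /=; apply: (@filterE _ U) => n /=.
  by rewrite in_itv /=; apply/andP; split; [exact: dens_ge0|exact: dens_le1].
exists p => A nA; have [//|nU] := in_ultra_setVsetC (dens E @^-1` A) UU.
have /cp-/(_ _ nA)[x []] : (dens E @ U) (~` A) by exact: nU.
by [].
Qed.

Definition ulim E : R := projT1 (cid (dens_cvg E)).

Lemma ulim_cvg E : dens E @ U --> ulim E.
Proof. exact: (projT2 (cid (dens_cvg E))). Qed.

Lemma ulim_unique E l : dens E @ U --> l -> ulim E = l.
Proof.
have PU := @ultra_proper _ _ UU; move=> h.
by apply: (cvg_unique (@Rhausdorff R)) h; apply: ulim_cvg.
Qed.

Let u_ge0 E : setT E -> 0 <= ulim E.
Proof.
have PU := @ultra_proper _ _ UU; move=> _; apply: cvgr_to_ge (@ulim_cvg E) _.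
by apply: filterE => n; apply: dens_ge0.
Qed.

Let uT : ulim setT = 1.
Proof.
apply: ulim_unique; apply: cvg_ultra_of_cvg.
apply: (@cvg_near_cst); exists 1%N => // n /= n0.
rewrite /dens; have -> : cnt setT n = n.
  by rewrite /cnt (eq_count (a2 := predT)) ?count_predT ?size_iota // => t; apply/asboolP.
by rewrite divff // pnatr_eq0 -lt0n.
Qed.

Let uU E F : setT E -> setT F -> E `&` F = set0 -> ulim (E `|` F) = ulim E + ulim F.
Proof.
have PU := @ultra_proper _ _ UU.
move=> _ _ EF; apply: ulim_unique.
have -> : dens (E `|` F) = (fun n => dens E n + dens F n).
  apply/funext => n; rewrite /dens -mulrDl -natrD; congr (_%:R / _).
  elim: n => [//|n IH]; rewrite !cntS IH addnACA; congr (_ + _)%N.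
  have [En|nE] := asboolP (E n); have [Fn|nF] := asboolP (F n) => /=.
  - by have : (E `&` F) n by []; rewrite EF.
  - by apply/eqP; rewrite eqb1; apply/asboolP; left.
  - by apply/eqP; rewrite eqb1; apply/asboolP; right.
  - by apply/eqP; rewrite eqb0; apply/asboolP => -[].
by apply: cvgD; apply: ulim_cvg.
Qed.

Definition nat_content : content R nat :=
  @Content R nat setT ulim I (fun _ _ => I) (fun _ _ _ _ => I) u_ge0 uT uU.

Lemma nat_content_eq E l : dens E @ U --> l -> pr nat_content E = l.
Proof. exact: ulim_unique. Qed.

Lemma cnt_shift E n : (cnt (S @^-1` E) n + `[< E 0%N >] = cnt E n + `[< E n >])%N.
Proof.
elim: n => [//|n IH]; rewrite !cntS -IH /= -!addnA; congr (_ + _)%N.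
by rewrite addnC.
Qed.

Lemma cvg_natV : (fun n => n%:R^-1 : R) @ \oo --> 0.
Proof.
apply: (@cvg_trans _ ((fun n => n.-1.+1%:R^-1 : R) @ \oo)).
  apply: near_eq_cvg; exists 1%N => // n /= n0; by rewrite prednK.
rewrite (_ : (fun n => _) = (@harmonic R) \o predn) //.
apply: cvg_comp (@cvg_harmonic R) => A [N _ hN]; exists N.+1 => // n /= hn.
by apply: hN => /=; lia.
Qed.

Lemma nat_content_inv : invariant_content nat_content S.
Proof.
have PU := @ultra_proper _ _ UU.
move=> E _; split=> //; apply: nat_content_eq.
have -> : dens (S @^-1` E) = (fun n => dens E n + (dens (S @^-1` E) n - dens E n)).
  by apply/funext => n; rewrite addrC subrK.
rewrite -[X in _ --> X]addr0; apply: cvgD; first exact: ulim_cvg.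
apply: cvg_ultra_of_cvg; apply: (squeeze_cvgr (f := fun n => - (n%:R^-1)) (h := fun n => n%:R^-1)).
- apply: filterE => n; rewrite -ler_norml /dens -mulrBl normrM normfV.
  rewrite (ger0_norm (ler0n R n)) -[leRHS]mul1r ler_wpM2r ?invr_ge0 //.
  have /(congr1 (fun k => k%:R : R)) := cnt_shift E n; rewrite !natrD => h.
  rewrite ler_norml.
  by case: `[< E 0%N >] h; case: `[< E n >] => /= h; apply/andP; split; lra.
- by rewrite -[X in _ --> X]oppr0; apply: cvgN; apply: cvg_natV.
- exact: cvg_natV.
Qed.

Lemma it_addn (A : Type) (X : nat -> A) i t : it S X i t = X (t + i)%N.
Proof. by rewrite /it; congr X; elim: i => [|i /= ->]; rewrite ?addn0 ?addnS. Qed.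

(* Double counting: [E] meets each interval of length [n] in at most [b] points. *)
Lemma nat_content_sparse E (n b : nat) :
  (forall t, (count (fun j => `[< E (t + j)%N >]) (iota 0 n) <= b)%N) ->
  n%:R * pr nat_content E <= b%:R.
Proof.
have PU := @ultra_proper _ _ UU.
move=> hE; pose F j := [set t | E (t + j)%N].
have prF j : pr nat_content (F j) = pr nat_content E.
  elim: j => [|j <-]; first by congr (pr _ _); apply/seteqP; split => t; rewrite /F /= addn0.
  have [_ <-] := nat_content_inv (I : ev nat_content (F j)).
  by congr (pr _ _); apply/seteqP; split => t; rewrite /F /= addSnnS.
have -> : n%:R * pr nat_content E = \sum_(j < n) pr nat_content (F j).
  by under eq_bigr do rewrite prF; rewrite sumr_const card_ord mulr_natl.
have cF m : (fun k => \sum_(j < m) dens (F j) k) @ U --> \sum_(j < m) pr nat_content (F j).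
  elim: m => [|m IH].
    rewrite big_ord0 (_ : (fun _ => _) = cst 0); first exact: cvg_cst.
    by apply/funext => k; rewrite big_ord0.
  rewrite big_ord_recr (_ : (fun _ => _) =
    (fun k => \sum_(j < m) dens (F j) k + dens (F m) k)).
    by apply: cvgD => //; apply: ulim_cvg.
  by apply/funext => k; rewrite big_ord_recr.
apply: cvgr_to_le (cF n) _; apply: filterE => k; rewrite -mulr_suml -natr_sum.
case: k => [|k]; first by rewrite invr0 mulr0.
rewrite ler_pdivrMr // -natrM ler_nat.
elim: {k}k.+1 => [|k IH]; first by rewrite big1 // muln0.
under eq_bigr do rewrite cntS; rewrite big_split /= mulnS addnC leq_add //.
apply: leq_trans (hE k).
rewrite -(big_mkord xpredT (fun j => nat_of_bool `[< F j k >])) /index_iota subn0.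
by rewrite -sum1_count [leqRHS]big_mkcond; apply: leq_sum => j _; case: ifP => // ->.
Qed.

End NatContent.

(** * Finite windows on sequence spaces *)

Section EntropyGrowth.
Context {R : realType} {Om : Type} (C : content R Om) (T : Om -> Om).
Hypothesis invT : invariant_content C T.
Variables (K : finType) (P : Om -> K).
Hypothesis rP : rv C P.

(** This and [zero_entropy_growth] translate between the [limn] in the definitions of entropy and
    the linear bounds used in block arguments. *)
Lemma entropy_rate_cvg0 :
  (forall e, 0 < e -> exists c, forall N : nat, H C (blk T P 0 N) <= c + e * N%:R) ->
  (fun n => H C (blk T P 0 n.+1) / n.+1%:R) @ \oo --> (0 : R).
Proof.
move=> h; apply/cvgrPdist_le => e e0.
have e20 : 0 < e / 2 by rewrite divr_gt0.
have [c hc] := h _ e20.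
exists (Num.truncn (c / (e / 2))) => // n /= hn.
have n0 : 0 < n.+1%:R :> R by [].
rewrite sub0r normrN ger0_norm; last first.
  by rewrite divr_ge0 // H_ge0 //; apply: rv_blk.
rewrite ler_pdivrMr //; apply: le_trans (hc _) _.
have : c <= e / 2 * n.+1%:R; last by lra.
rewrite mulrC -ler_pdivrMr //; apply: le_trans (ltW (truncnS_gt _)) _.
by rewrite ler_nat.
Qed.

Lemma zero_entropy_growth : limn (fun n => H C (blk T P 0 n.+1) / n.+1%:R) = 0 ->
  forall e, 0 < e -> exists c, forall N : nat, H C (blk T P 0 N) <= c + e * N%:R.
Proof.
move=> l0 e e0; pose Hn n := H C (blk T P 0 n).
have H0 n : 0 <= Hn n by apply: H_ge0; apply: rv_blk.
have avg n : n%:R * (Hn n.+1 - Hn n) <= Hn n.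
  elim: n => [|n IH]; first by rewrite mul0r.
  have h := incr_le invT rP (leqnSn n).
  apply: le_trans (_ : n.+1%:R * (Hn n.+1 - Hn n) <= _); first by rewrite ler_wpM2l.
  by rewrite -natr1; move: IH; lra.
pose u n := Hn n.+1 / n.+1%:R.
(* [limn] has a value even for a divergent sequence, so convergence must come first; it follows from
   the decrease of the averages, itself due to decreasing increments. *)
have du : nonincreasing_seq u.
  apply/nonincreasing_seqP => n; rewrite /u ler_pdivrMr // mulrAC ler_pdivlMr //.
  by have := avg n.+1; rewrite -[n.+2%:R]natr1; lra.
have cu : u @ \oo --> (0 : R).
  rewrite -l0; apply: nonincreasing_is_cvgn => //.
  by exists 0 => _ [n _ <-]; rewrite /u divr_ge0.
move/cvgrPdist_le: cu => /(_ e e0)[n0 _ hn0].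
exists (Hn n0.+1) => N; have [lt|] := ltnP N n0.+1.
  apply: le_trans (_ : Hn n0.+1 <= _); last by rewrite lerDl mulr_ge0 // ltW.
  have rn : rv C (blk T P 0 n0.+1) by apply: rv_blk.
  by apply: (H_le rn); apply: det_blk; rewrite // !add0n ltnW.
case: N => // N hN; have := hn0 N hN; rewrite /= sub0r normrN ger0_norm; last first.
  by rewrite divr_ge0.
rewrite /u ler_pdivrMr // => h; apply: le_trans h _.
by rewrite lerDr.
Qed.

End EntropyGrowth.

Section SequenceSpace.
Context {L : PointedCount.type}.
Implicit Types (x : nat -> L) (w : seq L).

Lemma windowP x x' i i' m :
  window x i m = window x' i' m <-> forall j, (j < m)%N -> x (i + j)%N = x' (i' + j)%N.
Proof.
rewrite /window; split=> [/eq_in_map h j jm|h].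
  by apply: h; rewrite mem_iota.
by apply/eq_in_map => j; rewrite mem_iota => /andP[_ jm]; apply: h.
Qed.

Lemma size_window x i m : size (window x i m) = m.
Proof. by rewrite size_map size_iota. Qed.

Lemma iter_shift x t n : iter t Defs.shift x n = x (t + n)%N.
Proof. by elim: t n => [//|t IH] n; rewrite iterS /Defs.shift IH addnS. Qed.

Definition finwin (n : nat) (E : set (nat -> L)) :=
  forall x x', (forall i, (i < n)%N -> x i = x' i) -> E x -> E x'.

(** The length-[n] cylinder whose word has code [i], kept if it lies in [E]: a countable alphabet
    makes finite-window events countable disjoint unions of cylinders. *)
Definition finwin_piece n (E : set (nat -> L)) (i : nat) : set (nat -> L) :=
  if pickle_inv i is Some w then
    if (size w == n) && `[< cyl w `<=` E >] then cyl w else set0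
  else set0.

Lemma finwin_pieceP n E i x : finwin_piece n E i x ->
  i = pickle (window x 0 n) /\ E x.
Proof.
rewrite /finwin_piece; have := @pickle_invK (seq L) i.
case: pickle_inv => //= w; case: ifP => // /andP[/eqP sw /asboolP wE] iw xw.
by split; [rewrite -iw -{1}xw sw|apply: wE].
Qed.

Lemma finwin_bigcup n E : finwin n E -> E = \bigcup_i finwin_piece n E i.
Proof.
move=> fE; apply/seteqP; split => x; last by move=> [i _ /finwin_pieceP[]].
move=> Ex; exists (pickle (window x 0 n)) => //.
rewrite /finwin_piece pickleK_inv size_window eqxx /=.
have -> : `[< cyl (window x 0 n) `<=` E >].
  apply/asboolP => x'; rewrite /cyl /= size_window => /windowP h.
  by apply: fE Ex => i hi; rewrite -(h i hi).
by rewrite /cyl /= size_window.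
Qed.

Lemma finwin_piece_disj n E i j : i != j ->
  finwin_piece n E i `&` finwin_piece n E j = set0.
Proof.
move=> /eqP ij; rewrite -subset0 => x [/finwin_pieceP[e1 _] /finwin_pieceP[e2 _]].
by apply: ij; rewrite e1 e2.
Qed.

Lemma measurable_cyl w : measurable (cyl w : set (Seq L)).
Proof. by apply: sub_gen_smallest; exists w. Qed.

Lemma measurable_finwin_piece n E i :
  measurable (finwin_piece n E i : set (Seq L)).
Proof.
rewrite /finwin_piece; case: pickle_inv => // w; case: ifP => // _.
exact: measurable_cyl.
Qed.

Lemma measurable_finwin n (E : set (Seq L)) : finwin n E -> measurable E.
Proof.
move=> fE; rewrite (finwin_bigcup fE); apply: bigcup_measurable => i _.
exact: measurable_finwin_piece.
Qed.

Lemma finwinC n E : finwin n E -> finwin n (~` E).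
Proof. by move=> fE x x' h nE Ex'; apply: nE; apply: fE Ex' => i /h. Qed.

Lemma measurable_shift (A : set (Seq L)) : measurable A ->
  measurable (@Defs.shift L @^-1` A : set (Seq L)).
Proof.
apply: (@smallest_sub _ (sigma_algebra setT) (@cylinders L)
  [set A | measurable (@Defs.shift L @^-1` A : set (Seq L))]); last first.
  move=> _ [w ->] /=; apply: (@measurable_finwin (size w).+1) => x x' h.
  rewrite /cyl /= => e; rewrite -[RHS]e; apply/windowP => j hj.
  by rewrite /Defs.shift h.
split => /=.
- by rewrite preimage_set0.
- by move=> B mB; rewrite setTD preimage_setC; apply: measurableC.
- by move=> F mF; rewrite preimage_bigcup; apply: bigcup_measurable.
Qed.

Context {R : realType}.
Variable mu : probability (Seq L) R.

Lemma shift_invariant_content : shift_invariant mu ->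
  invariant_content (prob_content mu) (@Defs.shift L).
Proof.
move=> inv A mA; split; first exact: measurable_shift.
by rewrite /= inv.
Qed.

(** Finite sums of cylinders only give that [mu] is at most [C]. The same inequality for the
    complement, with both total masses equal to 1, yields equality: no mass escapes through the
    infinite alphabet. *)
Lemma content_finwin (C : content R (nat -> L)) n E : (forall A, ev C A) ->
  (forall w, pr C (cyl w) = fine (mu (cyl w))) -> finwin n E ->
  pr C E = pr (prob_content mu) E.
Proof.
move=> evall cylE.
have le D : finwin n D -> pr (prob_content mu) D <= pr C D.
  move=> fD; pose F := finwin_piece n D.
  have muF i : mu (F i) = (pr C (F i))%:E.
    rewrite /F /finwin_piece; case: pickle_inv => [w|]; last by rewrite measure0 pr0.
    case: ifP => _; last by rewrite measure0 pr0.
    by rewrite cylE fineK // fin_num_measure //; apply: measurable_cyl.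
  rewrite -lee_fin -prob_contentE; last exact: measurable_finwin fD.
  rewrite {1}(finwin_bigcup fD).
  have tF : trivIset setT F.
    apply/trivIsetP => i j _ _ ij; exact: finwin_piece_disj.
  have mF i : measurable (F i : set (Seq L)) by apply: measurable_finwin_piece.
  have mU : measurable (\bigcup_i F i : set (Seq L)) by apply: bigcup_measurable.
  apply: cvge_to_le (measure_semi_sigma_additive _ mF tF mU) _.
  apply: filterE => k; rewrite big_mkord.
  rewrite (eq_bigr (fun i : 'I_k => (pr C (F i))%:E)); last by move=> i _; exact: muF.
  rewrite sumEFin lee_fin -(@pr_big _ _ _ _ predT (fun i : 'I_k => F i)) //.
    apply: pr_le => // x; elim/big_ind: _ => // [A B hA hB [/hA|/hB] //|i _].
    by move=> /finwin_pieceP[].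
  by move=> i j ij; apply: finwin_piece_disj.
move=> fE; apply/eqP; rewrite eq_le le // andbT.
have := le _ (finwinC fE); rewrite !prC //; first by lra.
exact: measurable_finwin fE.
Qed.

Lemma cpe_bool : shift_invariant mu -> CPE mu -> forall Q : Seq L -> bool,
  rv (prob_content mu) Q ->
  (forall e, 0 < e -> exists c, forall N : nat,
    H (prob_content mu) (blk (@Defs.shift L) Q 0 N) <= c + e * N%:R) ->
  law (prob_content mu) Q true = 0 \/ law (prob_content mu) Q true = 1.
Proof.
move=> inv cpe Q rQ zQ; set C := prob_content mu.
have invC := shift_invariant_content inv.
pose P x : 'I_2 := if Q x then 1%R else 0%R.
have dQP : det Q P by move=> x x'; rewrite /P => ->.
have dPQ : det P Q.
  by move=> x x'; rewrite /P; case: (Q x); case: (Q x').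
have rP : rv C P := rv_det rQ dQP.
have lawP (b : bool) : P @^-1` [set (if b then 1%R else 0%R)] = Q @^-1` [set b].
  apply/seteqP; split => x /=; rewrite /P; last by move=> ->.
  by case: (Q x); case: b.
apply: contrapT => /not_orP[n0 n1].
have lf : law C Q false = 1 - law C Q true.
  by have := law_sum1 rQ; rewrite big_bool /= -/C; lra.
have : 0 < part_entropy mu P.
  apply: cpe => [j|[j]]; first exact: (rP j).
  rewrite prob_contentE; last exact: (rP j).
  case=> e; have [j1|j0] : j = (if true then 1%R else 0%R) \/ j = (if false then 1%R else 0%R).
  - by case: (j) => -[|[|]] // ?; [right|left]; apply/val_inj.
  - by apply: n1; rewrite /law -(lawP true) -j1.
  - have : law C Q false = 1 by rewrite /law -(lawP false) -j0.
    by rewrite lf => e'; apply: n0; lra.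
have HE n : part_block_entropy mu P n = H C (blk (@Defs.shift L) Q 0 n).
  transitivity (H C (blk (@Defs.shift L) P 0 n)).
    rewrite /part_block_entropy /H; congr (- _); apply: eq_bigr => w _.
    rewrite /law; congr (xlnx (fine (mu _))); apply/seteqP; split => x /=.
      by move=> h; apply: eq_from_tnth => i; rewrite tnth_mktuple -h.
    by move=> <- i; rewrite tnth_mktuple.
  apply: H_eq; first exact: rv_blk.
    by move=> x x' /blkP h; apply/blkP => i /h; apply: dPQ.
  by move=> x x' /blkP h; apply/blkP => i /h; apply: dQP.
rewrite /part_entropy; under eq_fun do rewrite HE.
by rewrite (cvg_lim (@Rhausdorff R) (entropy_rate_cvg0 invC rQ zQ)) ltxx.
Qed.

End SequenceSpace.

(** * Ranks and gaps in a set of integers *)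

Section Counting.
Variable Y : pred nat.

Definition cY (t r : nat) : nat := count Y (iota t r).

Lemma cYD t r s : cY t (r + s) = (cY t r + cY (t + r) s)%N.
Proof. by rewrite /cY iotaD count_cat. Qed.

Lemma cY_le t r : (cY t r <= r)%N.
Proof. by rewrite -[leqRHS](size_iota t r) count_size. Qed.

Lemma cY_mono t r s : (r <= s)%N -> (cY t r <= cY t s)%N.
Proof. by move=> /subnKC <-; rewrite cYD leq_addr. Qed.

Lemma cY1 t : cY t 1 = Y t.
Proof. by rewrite /cY /= addn0. Qed.

Lemma cY_lt t r s : Y (t + r)%N -> (r < s)%N -> (cY t r < cY t s)%N.
Proof.
move=> Yr rs; apply: leq_trans (cY_mono t rs).
by rewrite -[r.+1]addn1 cYD cY1 Yr addn1.
Qed.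

Lemma cY_inj t r s : Y (t + r)%N -> Y (t + s)%N -> cY t r = cY t s -> r = s.
Proof.
move=> Yr Ys e; have [/(cY_lt Yr)|/(cY_lt Ys)|//] := ltngtP r s;
  by rewrite e ltnn.
Qed.

Lemma cY_onto t n j : (j < cY t n)%N ->
  exists r, [/\ (r < n)%N, Y (t + r)%N & cY t r = j].
Proof.
elim: n => [//|n IH]; rewrite -[n.+1]addn1 cYD cY1.
have [/IH[r [h1 h2 h3]] _|jn] := ltnP j (cY t n).
  by exists r; split => //; rewrite addn1; apply: ltnW.
case Yn: (Y (t + n)%N) => /= jn1; last by lia.
by exists n; split => //; lia.
Qed.

Lemma cY_offsets t r : cY t r = count (fun j => Y (t + j)%N) (iota 0 r).
Proof. by rewrite /cY -[t in LHS]addn0 iotaDl count_map; apply: eq_count. Qed.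

Lemma cY_window t t' r : (forall j, (j < r)%N -> Y (t + j)%N = Y (t' + j)%N) ->
  cY t r = cY t' r.
Proof.
move=> h; rewrite !cY_offsets; apply: eq_in_count => j.
by rewrite mem_iota => /andP[_ jr]; apply: h.
Qed.

(** The missing time [t.+1] wastes one offset, so at most [r - 1] of the [r] times are counted. This
    is the strict move to the right. *)
Lemma cY_skip t r j : Y t -> ~~ Y t.+1 -> Y (t + r)%N -> cY t r = j -> (0 < j)%N ->
  (j < r)%N.
Proof.
move=> Yt nY; case: r => [|[|r]] Yr <- //.
  by rewrite addn1 (negbTE nY) in Yr.
move=> _; have -> : cY t r.+2 = (1 + cY (t + 2) r)%N.
  have e : cY t 2 = 1%N by rewrite (cYD t 1 1) !cY1 addn1 Yt (negbTE nY).
  by rewrite -[r.+2]add2n cYD e.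
by have := cY_le (t + 2) r; lia.
Qed.

(** The [n] times following the first counted point include the rest of the interval and hold at
    most [b] points of [Y]. *)
Lemma sparse_long_gaps n b t :
  (count (fun j => `[< Y (t + j)%N /\ (cY (t + j) n <= b)%N >]) (iota 0 n) <= b)%N.
Proof.
suff h m j : (m <= n)%N ->
    (count (fun j => `[< Y (t + j)%N /\ (cY (t + j) n <= b)%N >]) (iota j m) <= b)%N.
  exact: h.
elim: m j => [//|m IH] j mn.
have [[Yj cb]|nE] := asboolP (Y (t + j)%N /\ (cY (t + j) n <= b)%N); last first.
  by rewrite /= asboolF // add0n; apply: IH; apply: ltnW.
apply: leq_trans cb; apply: leq_trans (cY_mono _ mn).
rewrite /cY -[iota (t + j) _]/(iota (t + j) m.+1) iotaDl count_map.
by apply: sub_count => i /= /asboolP[].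
Qed.

Lemma nth_in_cY t : Y t -> nth_in Y (cY 0 t) = t.
Proof.
move=> Yt; rewrite /nth_in.
pose A := [set n | Y n /\ count Y (iota 0 n) = cY 0 t].
have [h1 h2] : A (xget 0%N A) by apply: xgetPex; exists t.
by apply: (@cY_inj 0%N) => //; rewrite ?add0n.
Qed.

Lemma restr_cY (T : Type) (x : nat -> T) t r : Y (t + r)%N ->
  restr x Y (cY 0 t + cY t r)%N = x (t + r)%N.
Proof. by move=> Yr; rewrite /restr -[t in cY t r]add0n -cYD nth_in_cY. Qed.

Lemma count_sampled (D : pred nat) n :
  count (fun t => Y t && D (cY 0 t)) (iota 0 n) = count D (iota 0 (cY 0 n)).
Proof.
elim: n => [//|n IH]; rewrite -addn1 cYD cY1 !iotaD !count_cat IH /= addn0.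
by case: (Y n) => //=; rewrite addn0.
Qed.

Lemma cY_infty : ~ finite_set [set n | Y n] -> (fun n => cY 0 n) @ \oo --> \oo.
Proof.
move=> infY.
have unb k : exists n, (k <= cY 0 n)%N.
  elim: k => [|k [n hn]]; first by exists 0%N.
  have [t [nt Yt]] : exists t, (n <= t)%N /\ Y t.
    apply: contrapT => h; apply: infY; apply: (@sub_finite_set _ _ `I_n); last exact: finite_II.
    by move=> t /= Yt; rewrite ltnNge; apply/negP => nt; apply: h; exists t.
  exists t.+1; apply: leq_ltn_trans hn _.
  by apply: leq_ltn_trans (cY_mono 0 nt) _; apply: cY_lt.
move=> A [N _ hN]; have [n hn] := unb N.
by exists n => // m /= nm; apply: hN => /=; apply: leq_trans hn _; apply: cY_mono.
Qed.

End Counting.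

(** * Stationary binary processes without descents *)

Section BinaryProcess.
Context {R : realType} (C : content R nat).
Hypothesis evall : forall A, ev C A.
Hypothesis invS : invariant_content C S.
Variable Y : pred nat.

(** By stationarity ascents are as frequent as descents: each has the probability of [Y t] minus
    that of [Y t && Y t.+1]. *)
Let bad0 : pr C [set t | Y t && ~~ Y t.+1] = 0 ->
  pr C [set t | Y t != Y t.+1] = 0.
Proof.
move=> h; have inv1 : pr C [set t | Y t.+1] = pr C [set t | Y t].
  by have [_ <-] := invS (evall [set t | Y t]).
have e1 := prID (evall [set t | Y t]) (evall [set t | Y t.+1]).
have e2 := prID (evall [set t | Y t.+1]) (evall [set t | Y t]).
rewrite setIC in e2.
have e3 : [set t | Y t] `\` [set t | Y t.+1] = [set t | Y t && ~~ Y t.+1].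
  by apply/seteqP; split => t /=; [case=> -> /negP|case/andP => ? /negP].
rewrite e3 h in e1.
apply/eqP; rewrite eq_le pr_ge0 // andbT.
apply: le_trans (_ : pr C ([set t | Y t && ~~ Y t.+1] `|`
  ([set t | Y t.+1] `\` [set t | Y t])) <= _).
  apply: pr_le => // t /=; case y1: (Y t); case y2: (Y t.+1) => //= _; first by left.
  by right.
by apply: le_trans (pr_leU _ _) _ => //; lra.
Qed.

Lemma constant_words : pr C [set t | Y t && ~~ Y t.+1] = 0 -> forall b w,
  pr C [set t | window Y t (size w).+1 = b :: w] =
  pr C [set t | Y t = b] * (all (pred1 b) w)%:R.
Proof.
move=> /bad0 h b; elim=> [|c w IH] /=.
  rewrite mulr1; congr (pr C _); apply/seteqP; split => t; rewrite /window /= addn0.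
    by case.
  by move=> ->.
have winE t : window Y t (size w).+2 = b :: c :: w <->
    Y t = b /\ window Y t.+1 (size w).+1 = c :: w.
  have -> : window Y t (size w).+2 = Y t :: window Y t.+1 (size w).+1.
    rewrite /window /= addn0 -[1%N]addn0 -[X in _ :: X]/(map _ (iota (1 + 0) (size w).+1)).
    rewrite iotaDl -map_comp; congr (_ :: _); apply: eq_map => j /=.
    by rewrite addnA addn1.
  split=> [e|[e1 e2]]; last by rewrite e1 e2.
  by split; [have := congr1 (head b) e|have := congr1 behead e].
have sub0 (A : set nat) : A `<=` [set t | Y t != Y t.+1] -> pr C A = 0.
  by move=> /(pr_le (evall A) (evall _)); rewrite h => le0; apply/eqP; rewrite eq_le le0 pr_ge0.
have hd t : window Y t.+1 (size w).+1 = c :: w -> Y t.+1 = c.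
  by rewrite /window /= addn0 => -[].
have [cb|cb] := eqVneq c b; last first.
  rewrite mulr0; apply: sub0 => t /winE[e1 /hd e2].
  by rewrite /= e1 e2 eq_sym.
subst c; rewrite -IH.
have [_ <-] := invS (evall [set t | window Y t (size w).+1 = b :: w]).
rewrite (prID (evall (S @^-1` _)) (evall [set t | Y t = b])).
rewrite [X in _ = _ + X]sub0 ?addr0; last first.
  by move=> t /= [/hd -> /eqP].
congr (pr C _); apply/seteqP; split => t /=; first by move/winE => -[].
by move=> [h1 h2]; apply/winE.
Qed.

End BinaryProcess.

Lemma window_cyl (T : Type) (x : nat -> T) (t m : nat) (w : seq T) :
  cyl w (iter t Defs.shift x) <-> window x t (size w) = w.
Proof.
rewrite /cyl /=.
have -> : window (iter t Defs.shift x) 0 (size w) = window x t (size w).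
  by apply: eq_map => j; elim: t x => [//|t IH] y; rewrite iterSr IH /Defs.shift addSn.
by [].
Qed.

(** * Independence of the orbit from a zero-entropy set *)

Section Transfer.
Context {R : realType} {L : PointedCount.type}.
Variable mu : probability (Seq L) R.
Local Notation C := (prob_content mu).
Hypotheses (inv : shift_invariant mu) (cpe : CPE mu).

Let invC := shift_invariant_content inv.

Lemma cpe_seq_mixing (E : set (Seq L)) (K : finType) (P : Seq L -> K) (e : R) :
  measurable E -> rv C P -> 0 < e ->
  exists n, forall m, V C E (blk (@Defs.shift L) P n m) <= pr C E ^+ 2 + e.
Proof. by apply: cpe_mixing => //; apply: cpe_bool. Qed.

Lemma cpe_entropy_mixing (K : finType) (P : Seq L -> K) (e : R) :
  rv C P -> 0 < e ->
  exists n, forall m, H C P - e <= CH C P (blk (@Defs.shift L) P n m).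
Proof.
move=> rP e0; pose s := \sum_a (law C P a)^-1.
have s0 : 0 <= s by apply: sumr_ge0 => a _; rewrite invr_ge0 law_ge0.
pose e' := e / (s + 1); have e'0 : 0 < e' by rewrite divr_gt0 // ltr_wpDl.
have [n hn] := choice (fun a => cpe_seq_mixing (rP a) rP e'0).
exists (\max_a n a) => m.
have rB a k : rv C (blk (@Defs.shift L) P a k) by apply: rv_blk.
apply: le_trans (CH_ge_of_V rP (rB _ _) (_ : forall a, _ <= _ + e') (ltW e'0)).
  rewrite lerD2l lerN2 -/s /e' mulrAC ler_pdivrMr ?ltr_wpDl //.
  by rewrite ler_pM2l // lerDl.
move=> a; apply: le_trans (hn a (\max_a n a + m - n a)%N).
have na : (n a <= \max_a n a)%N by apply: leq_bigmax.
by apply: V_le; [exact: rP|exact: rB|apply: det_blk => //; lia].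
Qed.

Variables (NC : content R nat) (x : nat -> L).
Hypothesis evall : forall A, ev NC A.
Hypothesis invNC : invariant_content NC S.
Hypothesis hx : forall w : seq L,
  pr NC [set t | window x t (size w) = w] = fine (mu (cyl w)).

Let tau t : Seq L := iter t Defs.shift x.

Lemma pr_orbit n E : finwin n E -> pr NC (tau @^-1` E) = pr C E.
Proof.
move=> fE; pose D := push_content evall tau.
have -> : pr NC (tau @^-1` E) = pr D E by [].
apply: (content_finwin (n := n)) => // w.
rewrite -hx; congr (pr NC _).
by apply/seteqP; split => t; rewrite /= /preimage /= window_cyl.
Qed.

Definition finrv (K : Type) n (X : Seq L -> K) :=
  forall y y' : nat -> L, (forall i, (i < n)%N -> y i = y' i) -> X y = X y'.

Lemma rv_finrv (K : finType) n (X : Seq L -> K) : finrv n X -> rv C X.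
Proof.
move=> fX a; apply: (@measurable_finwin _ n) => y y' h /= <-.
by apply/esym/fX.
Qed.

Lemma finrv_blk (K : Type) n (X : Seq L -> K) a m :
  finrv n X -> finrv (a + m + n) (blk (@Defs.shift L) X a m).
Proof.
move=> fX y y' h; apply/blkP => i hi; rewrite /it; apply: fX => j hj.
by rewrite !iter_shift; apply: h; lia.
Qed.

Lemma H_orbit (K : finType) n (X : Seq L -> K) : finrv n X ->
  H NC (X \o tau) = H C X.
Proof.
move=> fX; rewrite /H; congr (- _); apply: eq_bigr => a _; congr xlnx.
rewrite /law comp_preimage; apply: (@pr_orbit n) => y y' h /= <-.
by apply/esym/fX.
Qed.

Lemma CH_orbit (K : finType) n (P : Seq L -> K) a m : finrv n P ->
  CH NC (P \o tau) (blk S (P \o tau) a m) = CH C P (blk (@Defs.shift L) P a m).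
Proof.
move=> fP; have blkE : blk S (P \o tau) a m = blk (@Defs.shift L) P a m \o tau.
  apply/funext => t; apply: eq_from_tnth => i.
  rewrite /= !tnth_mktuple /it /= /tau; congr P.
  by rewrite -iterD; congr (iter _ _ _); elim: (a + i)%N => //= k ->.
rewrite /CH blkE (H_orbit (finrv_blk (a := a) (m := m) fP)).
rewrite (_ : rpair _ _ = rpair P (blk (@Defs.shift L) P a m) \o tau) //.
rewrite (@H_orbit _ (a + m + n)) // => y y' h; apply/rpairP; split.
  by apply: fP => i hi; apply: h; lia.
exact: finrv_blk fP _ _ h.
Qed.

Variable Y : nat -> bool.
Hypothesis zY : forall e, 0 < e ->
  exists c, forall N : nat, H NC (blk S Y 0 N) <= c + e * N%:R.

(** Disjointness is applied to the indicator of [E], a two-valued observable, because the letters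
    may take infinitely many values. *)
Lemma orbit_indep n E l (Z : set nat) : finwin n E ->
  det (blk S Y 0 l) (fun t => `[< Z t >]) ->
  pr NC ((tau @^-1` E) `&` Z) = pr C E * pr NC Z.
Proof.
move=> fE dZ; pose P (y : Seq L) := `[< E y >].
have fP : finrv n P.
  move=> y y' h; apply/asboolP/asboolP; first exact: fE.
  by apply: fE => i hi; rewrite h.
have rP : rv C P := rv_finrv fP.
have mixP e : 0 < e -> exists k, forall m,
    H NC (P \o tau) - e <= CH NC (P \o tau) (blk S (P \o tau) k m).
  move=> e0; have [k hk] := cpe_entropy_mixing rP e0.
  by exists k => m; rewrite (CH_orbit _ _ fP) (H_orbit fP).
have rA (K : finType) (X : nat -> K) : rv NC X by move=> a; apply: evall.
have [g gE] := det_fun NC dZ.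
have ZE t : Z t <-> g (blk S Y 0 l t).
  by have := congr1 (fun f => f t) gE; rewrite /= => <-; split=> /asboolP.
have -> : pr NC Z = \sum_(b | g b) law NC (blk S Y 0 l) b.
  rewrite -pr_pred //; congr (pr NC _).
  by apply/seteqP; split => t /ZE.
have -> : pr C E = law NC (P \o tau) true.
  rewrite -(pr_orbit fE); congr (pr NC _).
  by apply/seteqP; split => t /= /asboolP.
have -> : (tau @^-1` E) `&` Z =
    [set t | [pred w | w.1 && g w.2] (rpair (P \o tau) (blk S Y 0 l) t)].
  apply/seteqP; split => t /=.
    by move=> [h1 /ZE h2]; apply/andP; split => //; apply/asboolP.
  by move=> /andP[/asboolP h1 /ZE h2].
rewrite pr_pred // mulr_sumr.
under [RHS]eq_bigr do rewrite -(disjoint_zero_entropy invNC (rA _ _) (rA _ _) mixP zY).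
rewrite big_mkcond [RHS]big_mkcond /=.
rewrite [LHS](_ : _ = \sum_a \sum_b (if a && g b then
    law NC (rpair (P \o tau) (blk S Y 0 l)) (a, b) else 0)); last first.
  by rewrite pair_bigA; apply: eq_bigr => -[a b].
by rewrite big_bool /= [X in _ + X]big1 ?addr0.
Qed.

End Transfer.

(** * Sampling along a zero-entropy set *)

Section SampledNormal.
Context {R : realType} {L : PointedCount.type}.
Variables (mu : probability (Seq L) R) (Y : pred nat) (x : nat -> L).
Variable U : set_system nat.
Hypotheses (UU : UltraFilter U) (Uoo : \oo `<=` U).
Local Notation NC := (@nat_content R U UU Uoo).

Lemma normal_content : normal mu x -> forall w : seq L,
  pr NC [set t | window x t (size w) = w] = fine (mu (cyl w)).
Proof.
move=> nx w; apply: nat_content_eq; apply: cvg_ultra_of_cvg => //.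
have -> : dens [set t | window x t (size w) = w] = (fun n => freq R x n w).
  apply/funext => n; rewrite /dens /freq /cnt; congr (_%:R / _).
  by apply: eq_count => t; apply/asboolP/eqP.
exact: nx.
Qed.

(** Counting points of [Y] up to time [n] is counting ranks up to [cY Y 0 n]. The density thus
    factors into that of [Y] and a frequency in [restr x Y], at a length tending to infinity since
    [Y] is infinite. *)
Lemma sampled_content : ~ finite_set [set n | Y n] -> normal mu (restr x Y) ->
  forall w : seq L,
  pr NC ([set t | Y t] `&` [set t | window (restr x Y) (cY Y 0 t) (size w) = w]) =
  pr NC [set t | Y t] * fine (mu (cyl w)).
Proof.
move=> infY nx' w; have PU := @ultra_proper _ _ UU.
pose D := [pred k | window (restr x Y) k (size w) == w].
apply: nat_content_eq.
rewrite (_ : dens _ = fun n => dens [set t | Y t] n * freq R (restr x Y) (cY Y 0 n) w).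
  apply: cvgM; first exact: ulim_cvg.
  apply: cvg_ultra_of_cvg => //.
  exact: cvg_comp (cY_infty infY) (nx' w).
apply/funext => n; rewrite /dens /freq /cnt.
rewrite (eq_count (a2 := fun t => Y t && D (cY Y 0 t))); last first.
  by move=> t; apply/asboolP/andP => -[h /eqP].
rewrite count_sampled (eq_count (a1 := fun t => `[< _ >]) (a2 := Y)); last first.
  by move=> t; apply/asboolP/idP.
rewrite -/(cY Y 0 n); have [->|c0] := posnP (cY Y 0 n); first by rewrite !mul0r.
rewrite [RHS]mulrC mulrA mulfVK // pnatr_eq0 -lt0n //.
Qed.

End SampledNormal.

Section Sampling.
Context {R : realType} {L : PointedCount.type}.
Variable mu : probability (Seq L) R.
Local Notation C := (prob_content mu).
Hypotheses (inv : shift_invariant mu) (cpe : CPE mu).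
Variables (Y : pred nat) (x : nat -> L).
Hypotheses (infY : ~ finite_set [set n | Y n]).
Hypotheses (nx : normal mu x) (nx' : normal mu (restr x Y)).
Variable U : set_system nat.
Hypotheses (UU : UltraFilter U) (Uoo : \oo `<=` U).
Local Notation NC := (@nat_content R U UU Uoo).
Hypothesis zY : forall e, 0 < e ->
  exists c, forall N : nat, H NC (blk S Y 0 N) <= c + e * N%:R.
Hypothesis gapY : 0 < pr NC [set t | Y t && ~~ Y t.+1].

Let evall : forall A, ev NC A := fun=> I.
Let invNC : invariant_content NC S := @nat_content_inv R U UU Uoo.
Let tau t : Seq L := iter t Defs.shift x.

(** With [Psi] as a parameter, both terms of the defect obey the same sampling identity. *)
Definition pattern_event (Psi : L -> seq L -> Prop) (a : seq nat) : set (nat -> L) :=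
  [set y | Psi (y 0%N) (map y a)].

Let dY := pr NC [set t | Y t].
Let p10 := pr NC [set t | Y t && ~~ Y t.+1].
Let p11 := pr NC [set t | Y t && Y t.+1].

Let dYE : dY = p10 + p11.
Proof.
rewrite /dY (prID (evall _) (evall [set t | Y t.+1])) addrC.
rewrite /p10 /p11; congr (_ + _); congr (pr NC _); apply/seteqP; split => t /=.
- by case=> -> /negP.
- by case/andP => ? /negP.
- by case=> -> ->.
- by case/andP.
Qed.

Let dY0 : 0 < dY.
Proof. by rewrite dYE; apply: (lt_le_trans gapY); rewrite lerDl pr_ge0. Qed.

Lemma finwin_pattern Psi a : finwin (\max_(i <- a) i).+1 (pattern_event Psi a).
Proof.
move=> y y' h; rewrite /pattern_event /= (h 0%N) //.
suff -> : map y a = map y' a by [].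
apply/eq_in_map => i ia; apply: h; rewrite ltnS.
by rewrite (leq_bigmax_seq (F := id)).
Qed.

Let xs t : nat -> L := fun i => restr x Y (cY Y 0 t + i)%N.

(** Conditioned on [t] being in [Y], the sampled sequence read from the rank of [t] has law [mu]:
    [sampled_content] gives cylinders, [content_finwin] the rest. *)
Lemma pr_sampled_pattern Psi a :
  pr NC ([set t | Y t] `&` [set t | pattern_event Psi a (xs t)]) =
  dY * pr C (pattern_event Psi a).
Proof.
pose D := push_content (fun A => I : ev (cond_content evall dY0) A) xs.
have -> : pr C (pattern_event Psi a) = pr D (pattern_event Psi a).
  apply/esym/(content_finwin _ _ (finwin_pattern (Psi := Psi) (a := a))) => // w.
  rewrite /= -/dY; apply: (mulIf (lt0r_neq0 dY0)); rewrite divfK ?lt0r_neq0 //.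
  rewrite [RHS]mulrC -(sampled_content UU Uoo infY nx' w).
  by congr (pr NC (_ `&` _)).
have -> : pr D (pattern_event Psi a) =
  pr NC ([set t | Y t] `&` [set t | pattern_event Psi a (xs t)]) / dY by [].
by rewrite mulrC divfK // lt0r_neq0.
Qed.

Section Cells.
Variables (n : nat) (a : seq nat).

(* [sampled_at t rho]: [t] lies in the sampling set and the points number [a_i] of
   the set after [t] are the [t + rho_i]. *)
Definition sampled_at (t : nat) (rho : (size a).-tuple 'I_n) : bool :=
  Y t && [forall i, Y (t + tnth rho i)%N && (cY Y t (tnth rho i) == tnth (in_tuple a) i)].

Definition sampled_pos (t : nat) : option ((size a).-tuple 'I_n) :=
  [pick rho | sampled_at t rho].

Lemma sampled_posP t rho : sampled_pos t = Some rho <-> sampled_at t rho.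
Proof.
rewrite /sampled_pos; case: pickP => [rho' h|h]; last by split=> // h'; rewrite h in h'.
split=> [[<-]//|h']; congr Some; apply: eq_from_tnth => i; apply: val_inj.
case/andP: h => _ /forallP/(_ i)/andP[h1 /eqP h2].
case/andP: h' => _ /forallP/(_ i)/andP[h1' /eqP h2'].
by apply: (cY_inj h1 h1'); rewrite h2 h2'.
Qed.

(** Failure means too few points among the [n] times from [t]; [sparse_long_gaps] makes such times
    rare. *)
Lemma sampled_pos_None t : Y t -> sampled_pos t = None ->
  (cY Y t n <= \max_(i <- a) i)%N.
Proof.
move=> Yt hN; rewrite leqNgt; apply/negP => hlt.
have ex (i : 'I_(size a)) : exists r : 'I_n,
    Y (t + r)%N && (cY Y t r == tnth (in_tuple a) i).
  have [|r [h1 h2 h3]] := @cY_onto Y t n (tnth (in_tuple a) i).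
    apply: leq_ltn_trans hlt.
    by apply: (leq_bigmax_seq (F := id)) => //; apply: mem_tnth.
  by exists (Ordinal h1); rewrite /= h2 h3 eqxx.
have [f hf] := choice ex.
have : sampled_at t [tuple f i | i < size a].
  by rewrite /sampled_at Yt; apply/forallP => i; rewrite tnth_mktuple.
by move/sampled_posP; rewrite hN.
Qed.

Lemma sampled_at_map t rho (T : Type) (y : nat -> T) : sampled_at t rho ->
  restr y Y (cY Y 0 t) = y t /\
  map (fun i => restr y Y (cY Y 0 t + i)%N) a = map (fun i => y (t + i)%N) (map val rho).
Proof.
move=> /andP[Yt /forallP h]; split.
  by have := @restr_cY Y _ y t 0; rewrite !addn0; apply.
rewrite -[a in LHS]/(tval (in_tuple a)) -map_comp.
suff : map_tuple (fun i => restr y Y (cY Y 0 t + i)%N) (in_tuple a) =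
    map_tuple (fun i : 'I_n => y (t + i)%N) rho by move/(congr1 val).
apply: eq_from_tnth => i; rewrite !tnth_map.
by have /andP[h1 /eqP <-] := h i; rewrite restr_cY.
Qed.

(** The length [n.+1] keeps time [t] itself in the block even when [n = 0]. *)
Lemma det_sampled_at rho :
  det (blk S Y 0 n.+1) (fun t => `[< sampled_at t rho >]).
Proof.
move=> t t' /blkP h.
have hY j : (j < n.+1)%N -> Y (t + j)%N = Y (t' + j)%N.
  by move=> hj; have := h j hj; rewrite !it_addn.
congr `[< is_true _ >]; rewrite /sampled_at.
have -> : Y t = Y t' by have := hY 0%N isT; rewrite !addn0.
congr (_ && _); apply: eq_forallb => i.
rewrite hY; last by apply: ltnW; rewrite ltnS ltn_ord.
rewrite (@cY_window Y t t') // => j hj; apply: hY.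
by apply: ltn_trans hj _; apply: ltnW; rewrite ltnS ltn_ord.
Qed.

Definition sampled_cell o := [set t | Y t] `&` (sampled_pos @^-1` [set o]).

(** On this cell the sampled pattern [a] is the pattern [rho] of [x] at time [t], and the cell
    depends on a block of [Y] only; independence separates the two. *)
Lemma pr_pattern_cell Psi rho :
  pr NC (([set t | Y t] `&` [set t | pattern_event Psi a (xs t)]) `&`
    (sampled_pos @^-1` [set Some rho])) =
  pr NC (sampled_cell (Some rho)) * pr C (pattern_event Psi (map val rho)).
Proof.
have WE : sampled_cell (Some rho) = [set t | sampled_at t rho].
  apply/seteqP; split => t; rewrite /sampled_cell /=; first by case=> _ /sampled_posP.
  by move=> h; split; [case/andP: h|apply/sampled_posP].
rewrite WE mulrC -(orbit_indep inv cpe evall invNC (normal_content UU Uoo nx) zY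
  (finwin_pattern (Psi := Psi) (a := map val rho)) (@det_sampled_at rho)) //.
congr (pr NC _); apply/seteqP; split => t /=; rewrite /pattern_event /=.
  move=> [[_ h] /sampled_posP hs]; split => //; move: h.
  have [h1 h2] := sampled_at_map x hs.
  rewrite /xs addn0 h1 h2 /preimage /= iter_shift addn0.
  by rewrite (eq_map (iter_shift x t)).
move=> [h hs]; have [h1 h2] := sampled_at_map x hs.
split; last exact/sampled_posP; split; first by case/andP: hs.
rewrite /xs addn0 h1 h2; move: h; rewrite /preimage /= iter_shift addn0.
by rewrite (eq_map (iter_shift x t)).
Qed.


End Cells.

(** Lets a defect be bounded only at positions that actually occur: for empty [A] both sides are
    0. *)
Lemma pr_mul_le (A : set nat) (z c : R) : (forall t, A t -> z <= c) ->
  pr NC A * z <= c * pr NC A.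
Proof.
move=> h; have [[t At]|nA] := pselect (exists t, A t).
  by rewrite mulrC ler_wpM2r ?pr_ge0 // (h t).
have -> : A = set0 by apply/seteqP; split => // t At; case: nA; exists t.
by rewrite pr0 mul0r mulr0.
Qed.

Variables (w0 : L) (w : seq L).

Let Psi1 (b : L) (s : seq L) := b = w0 /\ s = w.
Let Psi2 (b : L) (s : seq L) := s = w.
Let q := pr C [set y : nat -> L | y 0%N = w0].

Definition defect (a : seq nat) : R :=
  pr C (pattern_event Psi1 a) - q * pr C (pattern_event Psi2 a).

Let mpat Psi a : ev C (pattern_event Psi a).
Proof. exact: (measurable_finwin (finwin_pattern (Psi := Psi) (a := a))). Qed.

Let finwin_head : finwin 1 [set y : nat -> L | y 0%N = w0].
Proof. by move=> y y' h /= <-; rewrite h. Qed.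

Let mhead : ev C [set y : nat -> L | y 0%N = w0].
Proof. exact: (measurable_finwin finwin_head). Qed.

Let q01 : 0 <= q <= 1.
Proof. by rewrite pr_ge0 // pr_le1. Qed.

Lemma defect_le1 a : `|defect a| <= 1.
Proof.
rewrite ler_norml /defect; case/andP: q01 => q0 q1.
have F0 := pr_ge0 (mpat Psi1 a); have F1 := pr_le1 (mpat Psi1 a).
have G0 := pr_ge0 (mpat Psi2 a); have G1 := pr_le1 (mpat Psi2 a).
by apply/andP; split; nra.
Qed.

(** Up to truncation, [dY * defect a] is the sum of [defect rho] over the cells. If [t.+1] is
    missing, all positions have moved strictly right and [c] applies; otherwise they have not moved
    left and [c'] applies. [cY_skip] requires positive ranks, whence [0 < k]. *)
Lemma defect_step k c c' : (0 < k)%N -> 0 <= c -> 0 <= c' ->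
  (forall a, all (leq k.+1) a -> `|defect a| <= c) ->
  (forall a, all (leq k) a -> `|defect a| <= c') ->
  forall a, all (leq k) a -> dY * `|defect a| <= c * p10 + c' * p11.
Proof.
move=> k0 c0 c'0 hc hc' a ak; rewrite -subr_le0.
(* Offsets are truncated at [n]; the truncated cell has probability of order [n^-1], so the error
   disappears as [n] grows. *)
apply: (@le0_of_linear_bound _ _ (\max_(i <- a) i)%:R) => n.
pose X := @sampled_pos n a.
pose A10 := [set t | Y t && ~~ Y t.+1].
pose A11 := [set t | Y t && Y t.+1].
pose cell o := X @^-1` [set o].
have rX : rv NC X by move=> o; apply: evall.
pose E1 := [set t | Y t] `&` [set t | pattern_event Psi1 a (xs t)].
pose E2 := [set t | Y t] `&` [set t | pattern_event Psi2 a (xs t)].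
have e1 : dY * defect a = \sum_o (pr NC (E1 `&` cell o) - q * pr NC (E2 `&` cell o)).
  rewrite /defect mulrBr mulrCA -!pr_sampled_pattern.
  rewrite (pr_split rX (evall E1)) (pr_split rX (evall E2)) mulr_sumr.
  by rewrite -sumrB.
have sparse : n%:R * pr NC (sampled_cell (n := n) (a := a) None) <=
    (\max_(i <- a) i)%:R.
  pose B := [set t | Y t /\ (cY Y t n <= \max_(i <- a) i)%N].
  apply: le_trans (@nat_content_sparse R U UU Uoo B n _ (sparse_long_gaps Y n _)).
  rewrite ler_wpM2l //; apply: pr_le => // t [Yt hN]; split => //.
  exact: (sampled_pos_None Yt).
have term o : `|pr NC (E1 `&` cell o) - q * pr NC (E2 `&` cell o)| <=
    c * pr NC (A10 `&` cell o) + c' * pr NC (A11 `&` cell o) +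
    (o == None)%:R * pr NC (sampled_cell (n := n) (a := a) None).
  case: o => [rho|]; last first.
    rewrite eqxx mul1r.
    have b10 : 0 <= c * pr NC (A10 `&` cell None) by rewrite mulr_ge0 ?pr_ge0.
    have b11 : 0 <= c' * pr NC (A11 `&` cell None) by rewrite mulr_ge0 ?pr_ge0.
    have i1 : pr NC (E1 `&` cell None) <= pr NC (sampled_cell (n := n) (a := a) None).
      by apply: pr_le => // t [[? _] ?].
    have i2 : pr NC (E2 `&` cell None) <= pr NC (sampled_cell (n := n) (a := a) None).
      by apply: pr_le => // t [[? _] ?].
    have j1 : 0 <= pr NC (E1 `&` cell None) by apply: pr_ge0.
    have j2 : 0 <= pr NC (E2 `&` cell None) by apply: pr_ge0.
    case/andP: q01 => q0 q1.
    by rewrite ler_norml; apply/andP; split; nra.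
  rewrite mul0r addr0 /cell /X !pr_pattern_cell mulrCA -mulrBr normrM.
  rewrite (ger0_norm (pr_ge0 (evall _))) -/(defect _).
  have -> : pr NC (sampled_cell (Some rho)) =
      pr NC (A10 `&` cell (Some rho)) + pr NC (A11 `&` cell (Some rho)).
    rewrite (prID (evall _) (evall [set t | Y t.+1])) addrC.
    congr (_ + _); congr (pr NC _); apply/seteqP; split => t;
      rewrite /sampled_cell /A10 /A11 /cell /X /=.
    - by move=> [[-> ->] /negP ->].
    - by move=> [/andP[-> /negP ?] ->].
    - by move=> [[-> ->] ->].
    - by move=> [/andP[-> ->] ->].
  have ge_a t i : sampled_at t rho -> (tnth (in_tuple a) i <= tnth rho i)%N /\
      (Y t.+1 = false -> (tnth (in_tuple a) i < tnth rho i)%N).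
    move=> /andP[Yt /forallP/(_ i)/andP[h1 /eqP h2]]; split.
      by rewrite -h2 cY_le.
    move=> nY1; apply: (cY_skip Yt _ h1 h2); first by rewrite nY1.
    by apply: leq_trans k0 _; apply: (allP ak); apply: mem_tnth.
  have ka i : (k <= tnth (in_tuple a) i)%N by apply: (allP ak); apply: mem_tnth.
  rewrite mulrDl lerD //; apply: pr_mul_le => t [/andP[_ Y1] /sampled_posP hs].
    apply: hc; apply/allP => _ /mapP[_ /tnthP[i ->] ->].
    by have [_ /(_ (negbTE Y1))] := ge_a t i hs; apply: leq_ltn_trans.
  apply: hc'; apply/allP => _ /mapP[_ /tnthP[i ->] ->].
  by have [h _] := ge_a t i hs; apply: leq_trans h.
have sum10 : \sum_o pr NC (A10 `&` cell o) = p10 by rewrite -pr_split.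
have sum11 : \sum_o pr NC (A11 `&` cell o) = p11 by rewrite -pr_split.
have : dY * `|defect a| <= c * p10 + c' * p11 +
    pr NC (sampled_cell (n := n) (a := a) None).
  rewrite -(ger0_norm (ltW dY0)) -normrM e1.
  apply: le_trans (ler_norm_sum _ _ _) _.
  apply: le_trans (ler_sum _ (fun o _ => term o)) _.
  rewrite !big_split /= -!mulr_sumr sum10 sum11 lerD2l.
  rewrite (bigD1 None) //= mul1r big1 ?addr0 // => o /negbTE ->.
  by rewrite mul0r.
move=> h; apply: le_trans sparse; rewrite ler_wpM2l //.
by rewrite lerBlDl.
Qed.

(** Iterating [c' -> (1 - r) * c + r * c'] from [c + 1], which the trivial bound 1 allows, contracts
    to the fixed point [c]. Here [r] is the conditional probability that the next time is also in
    [Y], below 1 because of the gaps. *)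
Lemma defect_descend k c : (0 < k)%N -> 0 <= c ->
  (forall a, all (leq k.+1) a -> `|defect a| <= c) ->
  forall a, all (leq k) a -> `|defect a| <= c.
Proof.
move=> k0 c0 hc.
pose r := p11 / dY.
have r0 : 0 <= r by rewrite divr_ge0 ?pr_ge0 // ltW.
have r1 : r < 1 by rewrite ltr_pdivrMr // mul1r dYE ltrDr.
have iter_bound j a : all (leq k) a -> `|defect a| <= c + r ^+ j.
  elim: j a => [|j IH] a ak.
    by rewrite expr0; apply: le_trans (defect_le1 a) _; rewrite lerDr.
  have c'0 : 0 <= c + r ^+ j by rewrite addr_ge0 // exprn_ge0.
  have := defect_step k0 c0 c'0 hc IH ak.
  rewrite -ler_pdivlMl // => h; apply: (le_trans h).
  have p11E : p11 = r * dY by rewrite /r divfK // gt_eqF.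
  have p10E : p10 = (1 - r) * dY by rewrite mulrBl mul1r -p11E dYE addrK.
  rewrite p10E p11E le_eqVlt exprS; apply/orP; left; apply/eqP.
  by field; rewrite gt_eqF.
move=> a ak; apply/ler_addgt0Pr => e e0.
have : (fun j => r ^+ j) @ \oo --> (0 : R) by apply: cvg_expr; rewrite ger0_norm.
move/cvgrPdist_le => /(_ e e0)[N _ /(_ N (leqnn N))].
rewrite sub0r normrN ger0_norm ?exprn_ge0 // => hN.
by apply: le_trans (iter_bound N a ak) _; rewrite lerD2l.
Qed.

Lemma defect_remote e : 0 < e -> exists k,
  forall a, all (leq k) a -> `|defect a| <= e.
Proof.
(* All letters outside [w] share the index [size w]: this finite coding still decides whether a
   pattern spells [w]. *)
move=> e0; pose P (y : Seq L) : 'I_(size w).+1 := inord (index (y 0%N) w).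
have fP : finrv 1 P by move=> y y' h; rewrite /P h.
have rP := rv_finrv mu fP.
have e20 : 0 < e ^+ 2 by rewrite exprn_gt0.
have [k hk] := cpe_seq_mixing inv cpe mhead rP e20.
exists k => a ak.
pose m := (\max_(i <- a) i).+1; pose Z := blk (@Defs.shift L) P k m.
have rZ : rv C Z by apply: rv_blk => //; apply: shift_invariant_content.
have agree y y' : Z y = Z y' -> map y a = w -> map y' a = w.
  move=> /blkP h e1; rewrite -[RHS]e1; apply/eq_in_map => i ia.
  have ki : (k <= i < k + m)%N.
    rewrite (allP ak) //= addnS ltnS; apply: leq_trans (leq_addl _ _).
    by apply: (leq_bigmax_seq (F := id)).
  have yw : y i \in w by rewrite -e1; apply: map_f.
  have := congr1 (@nat_of_ord _) (h i ki); rewrite /it /P !iter_shift !addn0.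
  rewrite !inordK ?ltnS ?index_size // => e2.
  have y'w : y' i \in w by rewrite -index_mem -e2 index_mem.
  by rewrite -[LHS](nth_index point y'w) -e2 nth_index.
have dZ : det Z (fun y => `[< pattern_event Psi2 a y >]).
  move=> y y' h; apply/asboolP/asboolP; first exact: agree.
  exact/agree/esym.
have [g gE] := det_fun C dZ.
have BE : pattern_event Psi2 a = [set y | g (Z y)].
  apply/seteqP; split => y; have := congr1 (fun f => f y) gE; rewrite /= => <-.
    by move=> ?; apply/asboolP.
  by move/asboolP.
have := V_mixing g mhead rZ e0 (hk m); rewrite -BE /defect.
by congr (`|pr C _ - _| <= _).
Qed.

Lemma defect0 a : all (leq 1) a -> defect a = 0.
Proof.
move=> a1; apply/eqP; rewrite -normr_le0; apply/ler_addgt0Pr => e e0; rewrite add0r.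
have [k hk] := defect_remote e0.
have {hk} : forall a, all (leq k.+1) a -> `|defect a| <= e.
  by move=> b bk; apply: hk; apply: sub_all bk => i; apply: ltnW.
elim: k => [|k IH] hk; first exact: hk.
by apply: IH; apply: defect_descend hk => //; apply: ltW.
Qed.

Lemma cyl_cons_indep : pr C (cyl (w0 :: w)) = pr C (cyl [:: w0]) * pr C (cyl w).
Proof.
have a1 : all (leq 1) (iota 1 (size w)) by apply/allP => i; rewrite mem_iota => /andP[].
have := defect0 a1; rewrite /defect => /eqP; rewrite subr_eq0 => /eqP.
have -> : pattern_event Psi1 (iota 1 (size w)) = cyl (w0 :: w).
  apply/seteqP; split => y; rewrite /pattern_event /cyl /window /Psi1 /=.
    by case=> -> ->.
  by case=> -> ->.
have -> : pattern_event Psi2 (iota 1 (size w)) = @Defs.shift L @^-1` cyl w.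
  rewrite /pattern_event /cyl /window /Psi2; apply/seteqP; split => y;
    rewrite /preimage /= -[1%N]addn0 iotaDl -map_comp //.
have [_ ->] := shift_invariant_content inv (measurable_cyl w).
move=> ->; congr (pr C _ * _); apply/seteqP; split => y; rewrite /cyl /window /=.
  by move=> ->.
by case.
Qed.

End Sampling.

(** * From a derived measure to densities *)

Section Derived.
Context {R : realType}.
Variables (Y : pred nat) (nu : seq bool -> R) (U : set_system nat).
Hypotheses (UU : UltraFilter U) (Uoo : \oo `<=` U).
Local Notation NC := (@nat_content R U UU Uoo).
Hypothesis nuE : forall w : seq bool,
  pr NC [set t | window (fun n => Y n) t (size w) = w] = nu w.

Lemma derived_zero_growth : bin_entropy nu = 0 -> forall e, 0 < e ->
  exists c, forall N : nat, H NC (blk S Y 0 N) <= c + e * N%:R.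
Proof.
move=> nu0; have rY : rv NC Y by move=> b; apply: I.
apply: (zero_entropy_growth (@nat_content_inv R U UU Uoo) rY).
rewrite -[RHS]nu0 /bin_entropy; congr (limn _); apply/funext => n; congr (_ / _).
rewrite /bin_block_entropy /H; congr (- _); apply: eq_bigr => w _; congr xlnx.
rewrite -nuE /law; congr (pr NC _).
have E t : window (fun n => Y n) t n.+1 = blk S Y 0 n.+1 t.
  rewrite /window -val_enum_ord -map_comp /= /tup /=.
  by apply: eq_map => i; rewrite /= it_addn.
apply/seteqP; split => t; rewrite /= size_tuple.
  by move=> <-; rewrite E.
by move=> h; apply: val_inj; exact: etrans (esym (E t)) h.
Qed.

(** If gaps had density 0, [constant_words] would make [nu] a mixture of the two point masses, [a]
    being the density of the complement of [Y]. *)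
Lemma derived_gap : (forall a : R, ~ (0 <= a <= 1 /\ forall w : seq bool,
    nu w = a * (all negb w)%:R + (1 - a) * (all id w)%:R)) ->
  0 < pr NC [set t | Y t && ~~ Y t.+1].
Proof.
move=> nconv; rewrite lt_neqAle pr_ge0 ?andbT; last exact: I.
apply/eqP => /esym h0; apply: (nconv (pr NC [set t | Y t = false])).
split; first by rewrite pr_ge0 ?pr_le1.
have cw := constant_words (fun A => I : ev NC A) (@nat_content_inv R U UU Uoo) h0.
have e1 : pr NC [set t | Y t = true] = 1 - pr NC [set t | Y t = false].
  rewrite -prC //; congr (pr NC _); apply/seteqP; split => t /=; first by move=> ->.
  by case: (Y t).
case=> [|b w].
  rewrite !mulr1 addrC subrK -nuE -[RHS](prT NC); congr (pr NC _).
  by apply/seteqP; split.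
rewrite -nuE cw; case: b.
  by rewrite e1 /= mulr0 add0r; congr (_ * (nat_of_bool _)%:R); apply: eq_all => -[].
by rewrite /= mulr0 addr0; congr (_ * (nat_of_bool _)%:R); apply: eq_all => -[].
Qed.

End Derived.

Theorem mainTheorem5 (R : realType) (L : PointedCount.type)
  (mu : probability (Seq L) R) :
  shift_invariant mu -> CPE mu -> ~ bernoulli mu ->
  forall S : pred nat,
    ~ finite_set [set n | S n] ->
    ~ superficial R S ->
    deterministic R S ->
    forall x : Seq L, normal mu x -> ~ normal mu (restr x S).
Proof.
move=> inv cpe nbern Y infY nsup detY x nx nx'; apply: nbern.
have [nu [dnu nconv]] : exists nu : seq bool -> R, derived Y nu /\
    forall a : R, ~ (0 <= a <= 1 /\ forall w : seq bool,
      nu w = a * (all negb w)%:R + (1 - a) * (all id w)%:R).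
  apply: contrapT => h; apply: nsup => nu dnu; apply: contrapT => h'.
  by apply: h; exists nu; split => // a ha; apply: h'; exists a.
have [phi [phiS nuE]] := dnu.
have phi_ge j : (j <= phi j)%N by elim: j => // j IH; apply: leq_ltn_trans (phiS j).
(* [U] refines the tails along [phi], so densities along it are the values of [nu]; since [phi] is
   increasing it also contains every tail of [nat], so limits along [\oo] persist. *)
have [U [UU phiU]] := ultraFilterLemma (fmap_proper_filter phi eventually_filter).
have Uoo : \oo `<=` U.
  move=> A [N _ hN]; apply: phiU; exists N => // j /= Nj.
  by apply: hN => /=; apply: leq_trans (phi_ge j).
have prE (w : seq bool) : pr (@nat_content R U UU Uoo)
    [set t | window (fun n => Y n) t (size w) = w] = nu w.
  apply: nat_content_eq => A nA; apply: phiU; have := nuE w A nA.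
  rewrite (_ : (fun j => freq _ _ _ _) =
    dens [set t | window (fun n => Y n) t (size w) = w] \o phi) //.
  apply/funext => j; rewrite /freq /dens /cnt /=; congr (_%:R / _).
  by apply: eq_count => t; apply/eqP/asboolP.
have zY := derived_zero_growth prE (detY nu dnu).
have gapY := derived_gap prE nconv.
exists (fun a => fine (mu (cyl [:: a]))) => w.
elim: w => [|a w IH].
  by rewrite big_nil (_ : cyl [::] = setT) ?probability_setT //; apply/seteqP; split.
rewrite big_cons EFinM -IH.
rewrite prob_contentE; last exact: measurable_cyl.
rewrite (cyl_cons_indep inv cpe infY nx nx' zY gapY) EFinM; congr (_ * _)%E.
by rewrite -prob_contentE //; exact: measurable_cyl.
Qed.
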